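(* For every integer $d>2$, the $3$-torus $T^3=S^1\times S^1\times S^1$ is not weakly $d$-congruent to $\#^3\, S^1\times S^2$, the connected sum of three copies of $S^1\times S^2$.
   Context: Fix an integer $d>1$. All $3$-manifolds are closed and oriented, and are considered up to orientation-preserving homeomorphism. Let $M$ be such a manifold, let $\gamma\subset M$ be a simple closed curve, and let $N(\gamma)$ be a closed solid torus neighborhood of $\gamma$. A meridian $\mu\subset\partial N(\gamma)$ is a simple closed curve bounding a disk in $N(\gamma)$ that meets $\gamma$ transversely in one point. A longitude $\lambda\subset\partial N(\gamma)$ is a simple closed curve meeting $\mu$ transversely in one point. For coprime integers $a,b$, the $a/b$ Dehn surgery along $\gamma$ (with respect to $\mu,\lambda$) removes the interior of $N(\gamma)$ and glues in a solid torus so that a curve on $\partial N(\gamma)$ homologous to $a\mu+b\lambda$ bounds a meridian disk of the new solid torus. A weak type-$d$ surgery is a $q/(ds)$ Dehn surgery along a simple closed curve, where $s$ and $q$ are integers with $q$ relatively prime to $d$ and to $s$ (here $s$ and $q$ may vary while $d$ is fixed). The set of surgeries so described does not depend on the choice of $\mu$ and $\lambda$. Weak $d$-congruence is the equivalence relation on closed oriented $3$-manifolds generated by weak type-$d$ surgery. *)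

(* Defs.v *)
(* Manifolds are topological, modelled on [R ^ 3] for an arbitrary
   [R : realType].  A map defined on a subset is a total function together with
   the set on which its values matter. *)
From HB Require Import structures.
From mathcomp Require Import all_boot all_order all_algebra.
From mathcomp Require Import all_classical all_reals all_analysis.
From Stdlib Require List Relation_Operators.

Set Implicit Arguments.
Unset Strict Implicit.
Unset Printing Implicit Defensive.

Import Order.TTheory GRing.Theory Num.Theory.
Import numFieldNormedType.Exports.

Local Open Scope classical_set_scope.
Local Open Scope ring_scope.

(* [f] restricted to [A] is a homeomorphism onto its image. *)
Definition embeds (X Y : topologicalType) (A : set X) (f : X -> Y) : Prop :=
  {within A, continuous f} /\
  exists2 g : Y -> X,
    {within f @` A, continuous g} & forall x, A x -> g (f x) = x.

Definition homeomorphic (X Y : topologicalType) (A : set X) (B : set Y) : Prop :=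
  exists2 f : X -> Y, embeds A f & f @` A = B.

(* [Y] is the space obtained from the disjoint union of [A1] and [A2] by
   identifying [C1] (inside [A1]) with [C2] (inside [A2]) along the
   homeomorphism matching [i1] with [i2].  When [A1] and [A2] are compact and
   [Y] is Hausdorff, the topology of [Y] is automatically the quotient one. *)
Definition glued (X1 X2 Y : topologicalType) (A1 C1 : set X1) (A2 C2 : set X2)
    (i1 : X1 -> Y) (i2 : X2 -> Y) : Prop :=
  [/\ embeds A1 i1, embeds A2 i2, i1 @` A1 `|` i2 @` A2 = [set: Y],
      i1 @` A1 `&` i2 @` A2 = i1 @` C1 & i1 @` C1 = i2 @` C2].

(* The norm of ['rV[R]_n] in the library is the sup norm, hence the explicit
   Euclidean one. *)
Definition sqnorm (R : realType) (n : nat) (v : 'rV[R]_n) : R :=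
  \sum_(i < n) v ord0 i ^+ 2.

Definition sphere (R : realType) (n : nat) : set 'rV[R]_n.+1 :=
  [set v | sqnorm v = 1].

Definition disk (R : realType) (n : nat) : set 'rV[R]_n :=
  [set v | sqnorm v <= 1].

Definition open_disk (R : realType) (n : nat) : set 'rV[R]_n :=
  [set v | sqnorm v < 1].

Arguments sphere : clear implicits.
Arguments disk : clear implicits.
Arguments open_disk : clear implicits.

Definition circle_point (R : realType) (t : R) : 'rV[R]_2 :=
  \row_(i < 2) (if i == ord0 then cos (2 * pi * t) else sin (2 * pi * t)).

(* Local degree [1] at [x]: for all small [r], the map
   [v |-> g (x + r v) - g x] from the unit sphere to the complement of the
   origin is homotopic to the inclusion. *)
Definition local_degree_one (R : realType) (g : 'rV[R]_3 -> 'rV[R]_3)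
    (x : 'rV[R]_3) : Prop :=
  exists2 r0 : R, 0 < r0 & forall r : R, 0 < r < r0 ->
    exists H : R * 'rV[R]_3 -> 'rV[R]_3,
      [/\ {within [set t : R | 0 <= t <= 1] `*` sphere R 2, continuous H},
          forall t v, 0 <= t <= 1 -> sphere R 2 v -> H (t, v) != 0,
          forall v, sphere R 2 v -> H (0, v) = g (x + r *: v) - g x
        & forall v, sphere R 2 v -> H (1, v) = v].

(* Read through the charts [e] of [X] and [e'] of [Y], the map [f] has local
   degree [1] at all points of the open set [U] that it sends to the range of
   [e']. *)
Definition chart_orientation_preserving (R : realType) (X Y : topologicalType)
    (U : set X) (f : X -> Y) (e : 'rV[R]_3 -> X) (e' : 'rV[R]_3 -> Y) : Prop :=
  forall x y, U (e x) -> f (e x) = e' y ->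
    exists g : 'rV[R]_3 -> 'rV[R]_3,
      (\forall z \near x, e' (g z) = f (e z)) /\ local_degree_one g x.

Definition open_embedding (X Y : topologicalType) (e : X -> Y) : Prop :=
  [/\ continuous e, injective e & forall U : set X, open U -> open (e @` U)].

(* The orientation is given by an atlas of parametrizations by the whole of
   Euclidean space, not necessarily maximal. *)
Record oriented_closed_3manifold (R : realType) := OrientedClosed3Manifold {
  carrier :> topologicalType;
  manifold_hausdorff : hausdorff_space carrier;
  manifold_second_countable : @second_countable carrier;
  manifold_compact : compact [set: carrier];
  positive_chart : set ('rV[R]_3 -> carrier);
  positive_chart_open : forall e, positive_chart e -> open_embedding e;
  positive_chart_cover :
    forall p : carrier, exists2 e, positive_chart e & range e p;
  positive_chart_compatible : forall e1 e2,
    positive_chart e1 -> positive_chart e2 ->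
    chart_orientation_preserving [set: carrier] id e1 e2 }.

Arguments positive_chart {R}.

(* [U] is meant to be open, and [f] an embedding of [U]. *)
Definition orientation_preserving_on (R : realType)
    (M N : oriented_closed_3manifold R) (U : set M) (f : M -> N) : Prop :=
  forall e e', positive_chart M e -> positive_chart N e' ->
    chart_orientation_preserving U f e e'.

Definition oriented_homeomorphic (R : realType)
    (M N : oriented_closed_3manifold R) : Prop :=
  exists f : M -> N, [/\ embeds [set: M] f, range f = [set: N]
    & orientation_preserving_on [set: M] f].

(* Formal integer combinations.  A singular 1-simplex is a function on [R] of
   which only the restriction to [0, 1] matters; a singular 2-simplex is a
   function on [R * R] of which only the restriction to the standard triangle,
   with ordered vertices (0,0), (1,0), (0,1), matters. *)
Definition chain1 (R : realType) (X : Type) := seq (int * (R -> X)).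
Definition chain2 (R : realType) (X : Type) := seq (int * (R * R -> X)).

Definition coefficient (R : realType) (X : Type) (c : chain1 R X) (p : R -> X)
    : int :=
  \sum_(x <- c | `[< forall t : R, 0 <= t <= 1 -> x.2 t = p t >]) x.1.

Definition triangle (R : realType) : set (R * R) :=
  [set u | [/\ 0 <= u.1, 0 <= u.2 & u.1 + u.2 <= 1]].

Arguments triangle : clear implicits.

Definition boundary (R : realType) (X : Type) (c : chain2 R X) : chain1 R X :=
  flatten [seq [:: (x.1, fun t => x.2 (1 - t, t));
                   (- x.1, fun t => x.2 (0, t));
                   (x.1, fun t => x.2 (t, 0))] | x <- c].

Definition homologous_in (R : realType) (X : topologicalType) (B : set X)
    (c c' : chain1 R X) : Prop :=
  exists2 s : chain2 R X,
    List.Forall (fun x : int * (R * R -> X) => {within triangle R, continuous x.2} /\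
                          x.2 @` triangle R `<=` B) s
    & forall p, coefficient c p - coefficient c' p = coefficient (boundary s) p.

(* [phi] parametrizes an open tubular neighborhood by the product of the circle
   and the plane.  The closed solid torus neighborhood of the simple closed
   curve [phi (S^1 x 0)] is [phi (S^1 x D^2)]; it extends to an open one, so
   wildly embedded tori are excluded. *)
Definition tubular (R : realType) (X : topologicalType)
    (phi : 'rV[R]_2 * 'rV[R]_2 -> X) : Prop :=
  embeds (sphere R 1 `*` setT) phi /\ open (phi @` (sphere R 1 `*` setT)).

Definition meridian (R : realType) (X : Type)
    (phi : 'rV[R]_2 * 'rV[R]_2 -> X) : R -> X :=
  fun t => phi (circle_point 0, circle_point t).

Definition longitude (R : realType) (X : Type)
    (phi : 'rV[R]_2 * 'rV[R]_2 -> X) : R -> X :=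
  fun t => phi (circle_point t, circle_point 0).

(* [M'] is the result of [a / b] surgery on [M] along the core of [phi], with
   respect to [meridian phi] and [longitude phi]: [i] embeds the exterior in
   [M'], [j] embeds the new solid torus, whose meridian is matched with the
   curve [c].  The orientation of [M'] extends that of the exterior. *)
Definition dehn_surgery_along (R : realType)
    (M M' : oriented_closed_3manifold R) (a b : int)
    (phi : 'rV[R]_2 * 'rV[R]_2 -> M) : Prop :=
  let torus := phi @` (sphere R 1 `*` sphere R 1) in
  exists (i : M -> M') (j : 'rV[R]_2 * 'rV[R]_2 -> M') (c : R -> M),
    [/\ glued (~` (phi @` (sphere R 1 `*` open_disk R 2))) torus
              (sphere R 1 `*` disk R 2) (sphere R 1 `*` sphere R 1) i j,
        orientation_preserving_on (~` (phi @` (sphere R 1 `*` disk R 2))) i,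
        forall t, 0 <= t <= 1 -> torus (c t) /\ i (c t) = meridian j t
      & homologous_in torus [:: (1, c)]
          [:: (a, meridian phi); (b, longitude phi)]].

Definition dehn_surgery (R : realType) (M M' : oriented_closed_3manifold R)
    (a b : int) : Prop :=
  coprimez a b /\
  exists2 phi : 'rV[R]_2 * 'rV[R]_2 -> M,
    tubular phi & dehn_surgery_along M' a b phi.

Definition weak_surgery (R : realType) (d : int)
    (M M' : oriented_closed_3manifold R) : Prop :=
  exists q s : int,
    [/\ coprimez q d, coprimez q s & dehn_surgery M M' q (d * s)].

(* Orientation-preserving homeomorphisms are among the generators, because
   manifolds are considered up to those. *)
Definition weakly_congruent (R : realType) (d : int) :
    oriented_closed_3manifold R -> oriented_closed_3manifold R -> Prop :=
  Relation_Operators.clos_refl_sym_trans (oriented_closed_3manifold R)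
    (fun M M' => oriented_homeomorphic M M' \/ weak_surgery d M M').

(* Both [i1] and [i2] preserve the orientations, so that the boundary spheres
   are identified by an orientation-reversing homeomorphism. *)
Definition connected_sum (R : realType)
    (M1 M2 M : oriented_closed_3manifold R) : Prop :=
  exists (e1 : 'rV[R]_3 -> M1) (e2 : 'rV[R]_3 -> M2) (i1 : M1 -> M) (i2 : M2 -> M),
    [/\ open_embedding e1, open_embedding e2,
        glued (~` (e1 @` open_disk R 3)) (e1 @` sphere R 2)
              (~` (e2 @` open_disk R 3)) (e2 @` sphere R 2) i1 i2,
        orientation_preserving_on (~` (e1 @` disk R 3)) i1
      & orientation_preserving_on (~` (e2 @` disk R 3)) i2].

(* No orientation is singled out in the next three predicates: the 3-torus and
   the product of the circle and the 2-sphere both have orientation-reversing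
   self-homeomorphisms. *)
Definition is_torus3 (R : realType) (M : oriented_closed_3manifold R) : Prop :=
  homeomorphic [set: M] (sphere R 1 `*` sphere R 1 `*` sphere R 1).

Definition is_S1xS2 (R : realType) (M : oriented_closed_3manifold R) : Prop :=
  homeomorphic [set: M] (sphere R 1 `*` sphere R 2).

Definition is_sum3_S1xS2 (R : realType) (M : oriented_closed_3manifold R)
    : Prop :=
  exists A B C P : oriented_closed_3manifold R,
    [/\ is_S1xS2 A, is_S1xS2 B, is_S1xS2 C, connected_sum A B P
      & connected_sum P C M].

(* Main.v *)
(* Modulo d-th powers, the relation mu^q lambda^(ds) = 1 added by a weak type-d
   surgery says the same as mu = 1, because q is prime to d.  Hence flat bundles
   whose structure group G has exponent d correspond to each other on both sides
   of the surgery, and "every flat G-bundle has abelian holonomy" is invariant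
   under weak d-congruence.  It holds for the 3-torus, whose fundamental group
   is abelian, and fails for a sum of copies of S^1 x S^2, where two factors may
   be given arbitrary monodromies, as soon as G is not abelian.  For d > 2 the
   Heisenberg group over Z/d with doubled cocycle is not abelian and has
   exponent d.

   No fundamental group is used: flat bundles are given by local gauges, which
   can be restricted, pulled back and glued along closed sets. *)
From HB Require Import structures.
Require Import Defs.
From mathcomp Require Import all_boot all_order all_algebra.
From mathcomp Require Import all_classical all_reals all_analysis.
From mathcomp Require Import ring lra zify.

Set Implicit Arguments.
Unset Strict Implicit.
Unset Printing Implicit Defensive.

Import Order.TTheory GRing.Theory Num.Theory.
Import numFieldNormedType.Exports.

Local Open Scope classical_set_scope.
Local Open Scope ring_scope.

(** Speaking of holonomy groups would bring in base points and the connectedness of exteriors.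
    Instead, abelian holonomy means that the associated bundle, whose fibre consists of nonempty
    parts of cosets of abelian subgroups, has a flat section. Such a section restricts to the
    exterior of a curve and extends over any solid torus glued to it.

    To pass from one filling of an exterior to another, a bundle on the second filling is restricted
    to the exterior and extended over the first one, which is possible when the holonomy along the
    first meridian is trivial; the section found there is then restricted and extended back.

    The slope of a surgery is known only through a homology inside the boundary torus. Winding
    numbers turn that homology into the displacement of a lift to the plane, where holonomies can be
    compared.

    The bound on [d] comes from the structure group: a group of exponent 2 is abelian and detects
    nothing. *)

(** * Continuity on a subset *)

Lemma withinP (X Y : topologicalType) (A : set X) (f : X -> Y) :
  {within A, continuous f} <->
  forall x, A x -> forall W, nbhs (f x) W -> \forall y \near x, A y -> W (f y).
Proof. by rewrite subspace_continuousP; split. Qed.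

Lemma continuous_compose (X Y Z : topologicalType) (f : X -> Y) (g : Y -> Z) :
  continuous f -> continuous g -> continuous (fun x => g (f x)).
Proof. by move=> cf cg x; exact: continuous_comp (cf x) (cg (f x)). Qed.

Lemma continuous_pair (X Y Z : topologicalType) (f : X -> Y) (g : X -> Z) :
  continuous f -> continuous g -> continuous (fun x => (f x, g x)).
Proof. by move=> cf cg x; apply: cvg_pair; [exact: cf | exact: cg]. Qed.

Lemma continuous_fst (X Y : topologicalType) : continuous (@fst X Y).
Proof. by move=> x; exact: cvg_fst. Qed.

Lemma continuous_snd (X Y : topologicalType) : continuous (@snd X Y).
Proof. by move=> x; exact: cvg_snd. Qed.

Lemma continuous_idfun (X : topologicalType) : continuous (fun x : X => x).
Proof. by move=> x; exact: cvg_id. Qed.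

Lemma continuous_const (X Y : topologicalType) (y : Y) :
  continuous (fun _ : X => y).
Proof. by move=> x; exact: cvg_cst. Qed.

Lemma within_continuous (X Y : topologicalType) (A : set X) (f : X -> Y) :
  continuous f -> {within A, continuous f}.
Proof.
move=> cf; apply/withinP => x Ax W fW; have : nbhs x (f @^-1` W) by exact: cf.
by apply: filterS => y Wy _.
Qed.

Lemma within_comp (X Y Z : topologicalType) (A : set X) (B : set Y)
    (f : X -> Y) (g : Y -> Z) :
    {within A, continuous f} -> {within B, continuous g} ->
    (forall x, A x -> B (f x)) ->
  {within A, continuous (g \o f)}.
Proof.
move=> /withinP cf /withinP cg AB; apply/withinP => x Ax W gW.
have := cf _ Ax _ (cg _ (AB _ Ax) W gW).
by apply: filterS => y + Ay => /(_ Ay); apply; exact: AB.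
Qed.

Lemma within_subset (X Y : topologicalType) (A B : set X) (f : X -> Y) :
  B `<=` A -> {within A, continuous f} -> {within B, continuous f}.
Proof.
move=> BA /withinP cf; apply/withinP => x /[dup] Bx /BA Ax W /(cf _ Ax).
by apply: filterS => y + /BA.
Qed.

Lemma within_eq (X Y : topologicalType) (A : set X) (f g : X -> Y) :
  (forall x, A x -> f x = g x) -> {within A, continuous f} ->
  {within A, continuous g}.
Proof.
move=> fg /withinP cf; apply/withinP => x Ax W; rewrite -fg// => /(cf _ Ax).
by apply: filterS => y + Ay => /(_ Ay); rewrite fg.
Qed.

Lemma near_within_comp (X Y : topologicalType) (A : set X) (B : set Y)
    (f : X -> Y) (p : X) (P : Y -> Prop) :
    {within A, continuous f} -> (forall x, A x -> B (f x)) -> A p ->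
    (\forall y \near f p, B y -> P y) ->
  \forall x \near p, A x -> P (f x).
Proof.
move=> /withinP cf AB Ap /(cf _ Ap); apply: filterS => x + Ax.
by move=> /(_ Ax); apply; exact: AB.
Qed.

(** * Flat bundles with discrete fibre *)

(* The transport of a flat bundle from [p] to a point [x] near [p], in a gauge
   which need not be continuous, is [(h p p)^-1 * h p x].  Each [h p] matters
   only near [p], and only up to a left factor. *)
Definition same_germ (X : topologicalType) (G : groupType) (A : set X) (p : X)
    (u v : X -> G) : Prop :=
  exists k, \forall x \near p, A x -> v x = (k * u x)%g.

(** Choosing a point in every fibre, without any continuity, turns a flat bundle into such gauges,
    so neither a total space nor transition functions appear. The left factor relating the gauges at
    [p] and [q] may depend on [q] arbitrarily. *)
Definition local_system (X : topologicalType) (G : groupType) (A : set X)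
    (h : X -> X -> G) : Prop :=
  forall p, A p -> \forall q \near p, A q -> same_germ A q (h p) (h q).

Definition same_system (X : topologicalType) (G : groupType) (A : set X)
    (h k : X -> X -> G) : Prop :=
  forall p, A p -> same_germ A p (h p) (k p).

Definition right_action (S : Type) (G : groupType) (act : S -> G -> S) : Prop :=
  (forall s, act s 1%g = s) /\ forall s g k, act (act s g) k = act s (g * k)%g.

(** Flat sections of the associated bundle with fibre [S]. *)
Definition flat (X : topologicalType) (G : groupType) (S : Type)
    (act : S -> G -> S) (A : set X) (h : X -> X -> G) (f : X -> S) : Prop :=
  forall p, A p -> exists s, \forall x \near p, A x -> f x = act s (h p x).

(** A flat section of the principal bundle, that is, a global trivialization. *)
Definition frame (X : topologicalType) (G : groupType) (A : set X)
    (h : X -> X -> G) (u : X -> G) : Prop :=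
  flat (fun s g => s * g)%g A h u.

Definition pull (X Y : Type) (T : Type) (f : X -> Y) (h : Y -> Y -> T) :
  X -> X -> T := fun p x => h (f p) (f x).

Lemma regular_action (G : groupType) :
  right_action (fun s g : G => s * g)%g.
Proof. by split=> [s|s g k]; rewrite ?mulg1 ?mulgA. Qed.

Lemma actK (S : Type) (G : groupType) (act : S -> G -> S) (g : G) :
  right_action act -> cancel (act^~ g) (act^~ g^-1%g).
Proof. by move=> [a1 aM] s; rewrite /= aM mulgV a1. Qed.

Section LocalSystems.
Context (X : topologicalType) (G : groupType).
Implicit Types (A B : set X) (h k : X -> X -> G) (u v : X -> G).

Lemma same_germ_sym A p u v : same_germ A p u v -> same_germ A p v u.
Proof.
move=> [c cuv]; exists c^-1%g; apply: filterS cuv => x + Ax.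
by move=> /(_ Ax) ->; rewrite mulKg.
Qed.

Lemma same_germ_trans A p u v w :
  same_germ A p u v -> same_germ A p v w -> same_germ A p u w.
Proof.
move=> [c cuv] [d cvw]; exists (d * c)%g.
by apply: filterS2 cuv cvw => x uv vw Ax; rewrite vw// uv// mulgA.
Qed.

Lemma same_system_sym A h k : same_system A h k -> same_system A k h.
Proof. by move=> hk p /hk; exact: same_germ_sym. Qed.

Lemma same_system_trans A h k l :
  same_system A h k -> same_system A k l -> same_system A h l.
Proof. by move=> hk kl p Ap; exact: same_germ_trans (hk p Ap) (kl p Ap). Qed.

Lemma sub_local_system A B h : A `<=` B -> local_system B h -> local_system A h.
Proof.
move=> AB hB p /AB /hB; apply: filterS => q + /AB => /[apply] -[c cq].
by exists c; apply: filterS cq => x + /AB.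
Qed.

Lemma sub_same_system A B h k :
  A `<=` B -> same_system B h k -> same_system A h k.
Proof.
by move=> AB hk p /AB /hk [c cq]; exists c; apply: filterS cq => x + /AB.
Qed.

Lemma sub_flat S (act : S -> G -> S) A B h f :
  A `<=` B -> flat act B h f -> flat act A h f.
Proof.
by move=> AB hk p /AB /hk [c cq]; exists c; apply: filterS cq => x + /AB.
Qed.

Lemma same_system_flat S (act : S -> G -> S) A h k f : right_action act ->
  same_system A h k -> flat act A h f -> flat act A k f.
Proof.
move=> [a1 aM] hk ff p Ap; have [c chk] := hk p Ap; have [s fs] := ff p Ap.
exists (act s c^-1%g); apply: filterS2 chk fs => x hx fx Ax.
by rewrite fx// hx// aM mulKg.
Qed.

Lemma frame_flat S (act : S -> G -> S) A h u s : right_action act ->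
  frame A h u -> flat act A h (act s \o u).
Proof.
move=> [a1 aM] hu p Ap; have [c cu] := hu p Ap; exists (act s c).
by apply: filterS cu => x + Ax => /(_ Ax) /= ->; rewrite aM.
Qed.

Lemma frame_mul A h u c : frame A h u -> frame A h (fun x => c * u x)%g.
Proof. exact: (frame_flat c (regular_action G)). Qed.

Definition locally_constant_on (T : Type) A (f : X -> T) : Prop :=
  forall p, A p -> \forall x \near p, A x -> f x = f p.

(** Near [p] both [f] and [u] end with the same factor [h p x], which cancels. *)
Lemma flat_frame_constant S (act : S -> G -> S) A h u f : right_action act ->
  frame A h u -> flat act A h f ->
  locally_constant_on A (fun x => act (f x) (u x)^-1%g).
Proof.
move=> [a1 aM] hu hf p Ap; have [c cu] := hu p Ap; have [s fs] := hf p Ap.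
have fp := nbhs_singleton fs Ap; have up := nbhs_singleton cu Ap.
apply: filterS2 cu fs => x ux fx Ax.
by rewrite ux// fx// up fp !aM !invgM !mulVKg.
Qed.

End LocalSystems.

Lemma pull_local_system (X Y : topologicalType) (G : groupType) (A : set X)
    (B : set Y) (f : X -> Y) (h : Y -> Y -> G) :
    {within A, continuous f} -> (forall x, A x -> B (f x)) ->
  local_system B h -> local_system A (pull f h).
Proof.
move=> cf AB hB p Ap; have := near_within_comp cf AB Ap (hB _ (AB _ Ap)).
apply: filterS => q + Aq => /(_ Aq) -[c cq]; exists c.
exact: near_within_comp cf AB Aq cq.
Qed.

Lemma pull_same_system (X Y : topologicalType) (G : groupType) (A : set X)
    (B : set Y) (f : X -> Y) (h k : Y -> Y -> G) :
    {within A, continuous f} -> (forall x, A x -> B (f x)) ->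
  same_system B h k -> same_system A (pull f h) (pull f k).
Proof.
move=> cf AB hB p Ap; have [c cq] := hB _ (AB _ Ap); exists c.
exact: near_within_comp cf AB Ap cq.
Qed.

Lemma pull_flat (X Y : topologicalType) (G : groupType) (S : Type)
    (act : S -> G -> S) (A : set X) (B : set Y) (f : X -> Y)
    (h : Y -> Y -> G) (s : Y -> S) :
    {within A, continuous f} -> (forall x, A x -> B (f x)) ->
  flat act B h s -> flat act A (pull f h) (s \o f).
Proof.
move=> cf AB hB p Ap; have [c cq] := hB _ (AB _ Ap); exists c.
exact: near_within_comp cf AB Ap cq.
Qed.

Lemma eq_same_system (X : topologicalType) (G : groupType) (A : set X)
    (h k : X -> X -> G) :
  (forall p x, A p -> A x -> h p x = k p x) -> same_system A h k.
Proof.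
move=> hk p Ap; exists 1%g; apply: nearW => x Ax.
by rewrite mul1g hk.
Qed.

Lemma eq_flat (X : topologicalType) (G : groupType) (S : Type)
    (act : S -> G -> S) (A : set X) (h : X -> X -> G) (f g : X -> S) :
  (forall x, A x -> f x = g x) -> flat act A h f -> flat act A h g.
Proof.
move=> fg hf p Ap; have [s fs] := hf p Ap; exists s.
by apply: filterS fs => x + Ax; rewrite fg//; apply.
Qed.

Lemma near_notin (Y : topologicalType) (B : set Y) p :
  closed B -> ~ B p -> \forall x \near p, ~ B x.
Proof.
move=> cB nBp; have : nbhs p (~` B).
  by apply: open_nbhs_nbhs; split => //; exact: closed_openC.
by apply: filterS.
Qed.

(** Near a point outside a closed piece only the other piece is visible. At a common point [p] the
    two local parameters coincide, because both give the value of [f] at [p]. *)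
Lemma flat_glue (Y : topologicalType) (G : groupType) (B1 B2 : set Y)
    (S : Type) (act : S -> G -> S) (h : Y -> Y -> G) (f : Y -> S) :
    closed B1 -> closed B2 -> right_action act ->
  flat act B1 h f -> flat act B2 h f -> flat act (B1 `|` B2) h f.
Proof.
move=> cB1 cB2 [a1 aM] f1 f2 p p12.
have [p1|n1] := pselect (B1 p); last first.
  have p2 : B2 p by case: p12.
  have [s fs] := f2 p p2; exists s; apply: filterS2 fs (near_notin cB1 n1).
  by move=> x fx nx [//|]; exact: fx.
have [s fs] := f1 p p1.
have [p2|n2] := pselect (B2 p); last first.
  exists s; apply: filterS2 fs (near_notin cB2 n2).
  by move=> x fx nx [|//]; exact: fx.
have [t ft] := f2 p p2; exists s.
have /(congr1 (act^~ (h p p)^-1%g)) : act s (h p p) = act t (h p p).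
  by rewrite -(nbhs_singleton fs p1) -(nbhs_singleton ft p2).
rewrite /= !aM mulgV !a1 => st; rewrite -{}st {t} in ft.
by apply: filterS2 fs ft => x fx gx [].
Qed.

Section ClosedGluing.
Context (Y : topologicalType) (G : groupType) (B1 B2 : set Y).
Hypotheses (cB1 : closed B1) (cB2 : closed B2) (cover : B1 `|` B2 = setT).

Let cov x : B1 x \/ B2 x.
Proof. by have : (B1 `|` B2) x by rewrite cover. Qed.

Lemma local_system_glue (h1 h2 : Y -> Y -> G) :
    local_system B1 h1 -> local_system B2 h2 ->
    same_system (B1 `&` B2) h1 h2 ->
  exists h, [/\ local_system setT h, same_system B1 h h1
              & same_system B2 h h2].
Proof.
move=> l1 l2 h12.
have cov2 x : ~ B1 x -> B2 x by case: (cov x).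
(* [adj p] makes the second gauge agree with the first at [p]; by [h12] they then agree on the whole
   overlap near [p]. *)
pose adj p := ((h1 p p) * (h2 p p)^-1)%g.
pose h p x : G := if `[< B1 p >] then
  if `[< B2 p >] then if `[< B1 x >] then h1 p x else (adj p * h2 p x)%g
  else h1 p x
  else h2 p x.
have e1 : same_system B1 h h1.
  move=> p p1; exists 1%g; apply: nearW => x x1; rewrite mul1g /h.
  by rewrite (asboolT p1) (asboolT x1); case: ifP.
have e2 : same_system B2 h h2.
  move=> p p2; rewrite /h (asboolT p2).
  case: (asboolP (B1 p)) => p1; last first.
    by exists 1%g; apply: nearW => x _; rewrite mul1g.
  have [c cq] := h12 p (conj p1 p2).
  have cp := nbhs_singleton cq (conj p1 p2).
  have adjc : adj p = c^-1%g by rewrite /adj cp invgM mulVKg.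
  exists (adj p)^-1%g; apply: filterS cq => x hx x2; case: asboolP => x1.
    by rewrite adjc invgK hx.
  by rewrite mulKg.
exists h; split => // p _.
have near1 : \forall q \near p, B1 q -> same_germ B1 q (h p) (h q).
  have [p1|n1] := pselect (B1 p); last first.
    by apply: filterS (near_notin cB1 n1).
  have [c cq] := e1 p p1.
  apply: filterS2 (l1 p p1) (nbhs_interior cq) => q hq cq' q1.
  apply: same_germ_trans (same_germ_sym (e1 q q1)).
  by apply: same_germ_trans (hq q1); exists c.
have near2 : \forall q \near p, B2 q -> same_germ B2 q (h p) (h q).
  have [p2|n2] := pselect (B2 p); last first.
    by apply: filterS (near_notin cB2 n2).
  have [c cq] := e2 p p2.
  apply: filterS2 (l2 p p2) (nbhs_interior cq) => q hq cq' q2.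
  apply: same_germ_trans (same_germ_sym (e2 q q2)).
  by apply: same_germ_trans (hq q2); exists c.
apply: filterS2 near1 near2 => q h1q h2q _.
have [q1|n1] := pselect (B1 q); last first.
  have [c cq] := h2q (cov2 _ n1); exists c.
  by apply: filterS2 (near_notin cB1 n1) cq => x nx + _; apply; exact: cov2.
have [c cq] := h1q q1.
have [q2|n2] := pselect (B2 q); last first.
  exists c; apply: filterS2 (near_notin cB2 n2) cq => x nx + _; apply.
  by apply: contrapT => /cov2.
have [d dq] := h2q q2; exists c.
(* As [q] lies in both pieces, both factors can be read off at [q]. *)
have cd : c = d.
  by apply: (mulIg (h p q)); rewrite -(nbhs_singleton cq q1) (nbhs_singleton dq q2).
rewrite -{}cd in dq.
by apply: filterS2 cq dq => x x1 x2 _; have [/x1|/cov2/x2] := pselect (B1 x).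
Qed.

End ClosedGluing.

(** * Induction along a segment *)

Lemma near_diff (R : realType) (t : R) (W : set R) : nbhs t W ->
  exists2 e : R, 0 < e & forall x, `|x - t| < e -> W x.
Proof.
by move=> /nbhs_ballP[e /= e0 eW]; exists e => // x; rewrite distrC => /eW.
Qed.

(** Around the supremum of the points reached from [a], a single step leads from a point just below
    it to a point above it, unless [b] has been reached. *)
Lemma creeping (R : realType) (a b : R) (Q : R -> R -> Prop) : a <= b ->
    (forall x y z, x <= y -> y <= z -> Q x y -> Q y z -> Q x z) ->
    (forall t, a <= t <= b -> exists2 e : R, 0 < e & forall x y : R,
      `|x - t| < e -> `|y - t| < e -> a <= x -> x <= y -> y <= b -> Q x y) ->
  Q a b.
Proof.
move=> ab trans loc; pose S := [set y | a <= y <= b /\ Q a y].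
have Sa : S a.
  split; first by rewrite lexx ab.
  have [|e e0 ae] := loc a; first by rewrite lexx ab.
  by apply: ae; rewrite ?subrr ?normr0.
have supS : has_sup S.
  by split; [exists a | exists b => y [/andP[]]].
set m := sup S.
have am : a <= m by apply: ub_le_sup => //; case: supS.
have mb : m <= b.
  by apply: ge_sup; [case: supS | move=> y [/andP[]]].
have [|e e0 me] := loc m; first by rewrite am mb.
have [y Sy ym] := sup_adherent e0 supS; rewrite -/m in ym.
have ley : y <= m by apply: ub_le_sup => //; case: supS.
case: Sy => /andP[ay yb] Qy.
set z := Num.min b (m + e / 2).
have e20 : 0 < e / 2 by rewrite divr_gt0.
have e2e : e / 2 < e by rewrite ltr_pdivrMr// mulr_natr mulr2n ltrDl.
have mz : m <= z by rewrite le_min mb lerDl ltW.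
have Qz : Q a z.
  apply: (trans _ y) => //; first exact: le_trans mz.
  apply: me => //.
  - by rewrite ltr_distl ym (le_lt_trans ley)// ltrDl.
  - rewrite ltr_distl (lt_le_trans _ mz) ?ltrBlDr ?ltrDl//=.
    by rewrite gt_min ltrD2l e2e orbT.
  - exact: le_trans mz.
  - by rewrite ge_min lexx.
have zm : z <= m.
  apply: ub_le_sup; first by case: supS.
  split=> //; rewrite (le_trans am mz)/=.
  by rewrite ge_min lexx.
by move: zm Qz; rewrite /z; case: (leP b) => // _; rewrite gerDl leNgt e20.
Qed.

Lemma segment_constant (R : realType) (a b : R) (T : Type) (f : R -> T) :
  a <= b -> locally_constant_on `[a, b] f -> f a = f b.
Proof.
move=> ab lf; apply: (creeping (Q := fun x y => f x = f y)) => //.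
  by move=> x y z _ _ -> .
move=> t tab; have tab2 : `[a, b]%classic t by rewrite /= in_itv.
have /near_diff[e e0 et] := lf t tab2.
exists e => // x y xt yt ax xy yb.
rewrite (et x)// ?(et y)//= in_itv /=.
  by rewrite yb (le_trans ax).
by rewrite ax (le_trans xy).
Qed.

Lemma segment_frame (R : realType) (G : groupType) (h : R -> R -> G) :
  local_system `[(0 : R), 1] h -> exists2 u, frame `[(0 : R), 1] h u & u 0 = 1%g.
Proof.
move=> lh; pose Q (x y : R) := exists u, frame `[x, y] h u.
suff [u hu] : Q 0 1.
  by exists (fun x => (u 0)^-1 * u x)%g; [exact: frame_mul | rewrite mulVg].
apply: creeping => //.
- move=> x y z xy yz [u hu] [v hv].
  (* The second frame is multiplied by the left factor that makes it agree with the first at [y]. *)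
  pose w t : G := if t <= y then u t else (u y * (v y)^-1 * v t)%g.
  exists w; have -> : `[x, z]%classic = `[x, y] `|` `[y, z].
    apply/seteqP; split=> t /=; rewrite !in_itv/=.
      by move=> /andP[xt tz]; case: (leP t y) => [ty|/ltW yt]; [left|right];
        rewrite ?xt ?ty ?yt ?tz.
    by move=> [/andP[xt ty]|/andP[yt tz]]; rewrite ?xt ?tz ?(le_trans ty)// (le_trans xy).
  apply: flat_glue; try exact: interval_closed; first exact: regular_action.
    by apply: eq_flat hu => t; rewrite /= in_itv/= => /andP[_ ty]; rewrite /w ty.
  apply: eq_flat (frame_mul (u y * (v y)^-1)%g hv) => t.
  rewrite /= in_itv/= => /andP[yt _]; rewrite /w; case: leP => // ty.
  by have -> : t = y; [apply/le_anti; rewrite ty yt | rewrite mulgVK].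
- move=> t t01; have t01c : `[(0 : R), 1]%classic t by rewrite /= in_itv.
  have /near_diff[e e0 et] := lh t t01c.
  exists e => // x y xt yt x0 xy y1; exists (h t) => p; rewrite /= in_itv/=.
  move=> /andP[xp py].
  have p01 : `[(0 : R), 1]%classic p by rewrite /= in_itv/= (le_trans x0)//= (le_trans py).
  have pt : `|p - t| < e.
    move: xt yt; rewrite !ltr_distl => /andP[xt _] /andP[_ yt].
    by rewrite (lt_le_trans xt)//= (le_lt_trans py).
  have [c cp] := same_germ_sym (et p pt p01).
  exists c; apply: filterS cp => s + /=; rewrite !in_itv/=; move=> + /andP[xs sy].
  by apply; rewrite in_itv/= (le_trans x0)//= (le_trans sy).
Qed.

(** * Simple connectivity *)

(** Time runs from the constant map to the identity, so that transport goes outwards from [k0] along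
    the paths [H (t, k)]. *)
Definition contraction (R : realType) (K : topologicalType) (B : set K)
    (H : R * K -> K) (k0 : K) : Prop :=
  [/\ continuous H, B k0, forall t k, 0 <= t <= 1 -> B k -> B (H (t, k)),
      forall k, H (0, k) = k0 & forall k, H (1, k) = k].

Definition contractible (R : realType) (K : topologicalType) (B : set K) :=
  exists (H : R * K -> K) (k0 : K), contraction B H k0.

Arguments contractible : clear implicits.

Lemma contractible_prod (R : realType) (K L : topologicalType) (B : set K)
    (C : set L) :
  contractible R K B -> contractible R L C ->
  contractible R (K * L)%type (B `*` C).
Proof.
move=> [H [k [cH Bk BH H0 H1]]] [J [l [cJ Cl CJ J0 J1]]].
exists (fun x => (H (x.1, x.2.1), J (x.1, x.2.2))), (k, l).
split=> [|//|t x t01 [? ?]|x|[? ?]]; rewrite ?H0 ?J0 ?H1 ?J1//=; last first.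
  by split; [exact: BH | exact: CJ].
have c2 (Q : topologicalType) (f : K * L -> Q) : continuous f ->
    continuous (fun x : R * (K * L) => f x.2).
  by move=> cf; apply: continuous_compose cf; exact: continuous_snd.
by apply: continuous_pair; [apply: (continuous_compose _ cH) |
  apply: (continuous_compose _ cJ)]; apply: continuous_pair;
  (exact: continuous_fst || apply: c2;
   (exact: continuous_fst || exact: continuous_snd)).
Qed.

Section Contraction.
Context (R : realType) (K : topologicalType) (B : set K).
Context (H : R * K -> K) (k0 : K).
Hypothesis cB : contraction B H k0.

Let path_continuous k : continuous (fun t => H (t, k)).
Proof.
case: cB => cH _ _ _ _; apply: (continuous_compose _ cH).
by apply: continuous_pair; [exact: continuous_idfun | exact: continuous_const].
Qed.

Let path_in k t : B k -> `[(0 : R), 1]%classic t -> B (H (t, k)).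
Proof.
by case: cB => _ _ BH _ _ Bk; rewrite /= in_itv/= => t01; exact: BH.
Qed.

Lemma contraction_constant (T : Type) (f : K -> T) :
  locally_constant_on B f -> forall x y, B x -> B y -> f x = f y.
Proof.
move=> lf; suff fk0 x : B x -> f x = f k0.
  by move=> x y Bx By; rewrite !fk0.
case: cB => cH Bk0 BH H0 H1 Bx; rewrite -(H1 x) -(H0 x); apply/esym.
apply: (segment_constant (f := fun t => f (H (t, x)))) => // t t01.
have := near_within_comp (within_continuous (@path_continuous x)) (fun s => @path_in _ s Bx) t01
  (lf _ (path_in Bx t01)).
exact.
Qed.

Let segment_same (G : groupType) (A : set R) (h : R -> R -> G) u v a b :
    a <= b -> `[a, b] `<=` A -> frame A h u ->
    (forall p, `[a, b]%classic p -> same_germ A p (h p) v) ->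
  (u a * (v a)^-1 = u b * (v b)^-1)%g.
Proof.
move=> ab bA fu hv; pose f x := (u x * (v x)^-1)%g.
have fv : frame `[a, b] h v.
  move=> p pab; have [c cp] := hv p pab; exists c.
  by apply: filterS cp => x + xab; apply; exact: bA.
have := flat_frame_constant (regular_action G) fv (sub_flat bA fu).
exact: segment_constant.
Qed.

(** The frame at [k] is the transport along the path that the contraction draws from [k0] to [k].
    The point is that transports along neighbouring paths fit together; this is carried from time 0
    to time 1 by [creeping]. *)
Lemma contraction_frame (G : groupType) (h : K -> K -> G) :
  local_system B h -> exists u, frame B h u.
Proof.
move=> lh; case: (cB) => cH Bk0 BH H0 H1.
pose path k t := H (t, k).
have lpath k : B k -> local_system `[(0 : R), 1] (pull (path k) h).
  move=> Bk; apply: pull_local_system lh.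
    exact: within_continuous (@path_continuous k).
  by move=> x; exact: path_in.
have /choice[w Hw] k : exists w : R -> G, B k ->
    frame `[(0 : R), 1] (pull (path k) h) w /\ w 0 = 1%g.
  have [Bk|nBk] := pselect (B k); last by exists (fun=> 1%g).
  by have [u ? ?] := segment_frame (lpath k Bk); exists u.
exists (w^~ 1) => k Bk.
(* Up to one left factor, the transports at time [t] along all paths near that of [k] are given by
   the gauge at [path k t]. *)
pose T t := exists c, \forall k' \near k, B k' ->
  w k' t = (c * h (path k t) (path k' t))%g.
suff [c cT] : T 1.
  exists c; apply: filterS cT => k' + Bk' => /(_ Bk') ->.
  by rewrite /path !H1.
have T0 : T 0.
  exists (h k0 k0)^-1%g; apply: nearW => k' Bk'.
  by rewrite /path !H0 mulVg; case: (Hw k' Bk').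
apply: (creeping (Q := fun a b => T a -> T b) ler01) => // [x y z _ _ xy yz /xy /yz//|].
move=> t t01; have t01c : `[(0 : R), 1]%classic t by rewrite /= in_itv.
set p := path k t.
(* On the product neighborhood [U] x [V] of [(t, k)], the single gauge at [p] serves for all times
   and all paths. *)
have [[U V] /= [/near_diff[e e0 Ut] Vk] UV] :=
  cH (t, k) _ (lh p (path_in Bk t01c)).
exists e => // a b ta tb a0 ab b1.
have sub x y : `|x - t| < e -> `|y - t| < e -> forall z, x <= z <= y -> U z.
  move=> xt yt z /andP[xz zy]; apply: Ut; move: xt yt.
  rewrite !ltr_distl => /andP[xt _] /andP[_ yt].
  by rewrite (lt_le_trans xt)//= (le_lt_trans zy).
have in01 x : a <= x <= b -> `[(0 : R), 1]%classic x.
  by move=> /andP[ax xb]; rewrite /= in_itv/= (le_trans a0)//= (le_trans xb).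
have near_path x : a <= x <= b -> exists d, \forall k' \near k, B k' ->
    h p (path k' x) = (d * h (path k x) (path k' x))%g.
  move=> xab; have [|d dx] := same_germ_sym (UV (x, k) _ (path_in Bk (in01 _ xab))).
    by split; [exact: sub xab | exact: nbhs_singleton].
  exists d.
  have := cH (x, k) _ dx; case=> -[U' V'] /= [U'x V'k] UV'.
  apply: filterS V'k => k' V'k' Bk'; apply: (UV' (x, k')) => /=.
    by split=> //; exact: nbhs_singleton.
  exact: path_in Bk' (in01 _ xab).
have eqab : \forall k' \near k, B k' ->
    (w k' a * (h p (path k' a))^-1 = w k' b * (h p (path k' b))^-1)%g.
  apply: filterS Vk => k' Vk' Bk'.
  apply: (segment_same (v := fun x => h p (path k' x)) ab _ (proj1 (Hw k' Bk'))) => [x|x].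
    by rewrite /= in_itv/= => /in01.
  rewrite /= in_itv/= => xab.
  have Bx := path_in Bk' (in01 _ xab).
  have [|d dx] := same_germ_sym (UV (x, k') _ Bx).
    by split => //; exact: sub xab.
  exists d; have := near_within_comp (within_continuous (@path_continuous k'))
    (fun s => @path_in _ s Bk') (in01 _ xab) dx.
  exact.
have [|da Ha] := near_path a; first by rewrite lexx.
have [|db Hb] := near_path b; first by rewrite lexx ab.
(* [da] and [db] convert the gauges at times [a] and [b] into the gauge at [p]; neither depends on
   [k']. *)
move=> [c cT]; exists (c * da^-1 * db)%g.
apply: filterS (filterI (filterI Ha Hb) (filterI eqab cT)).
move=> k' [[ha hb] [eqk ck]] Bk'.
have := eqk Bk'; rewrite ck// ha// invgM mulgA mulgK => /esym.
by move=> /(canRL (mulgVK _)) ->; rewrite hb// mulgA.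
Qed.

End Contraction.

Lemma contractible_frame (R : realType) (K : topologicalType) (B : set K)
    (G : groupType) (h : K -> K -> G) :
  contractible R K B -> local_system B h -> exists u, frame B h u.
Proof. by move=> [H [k cB]] lh; exact: (contraction_frame cB lh). Qed.

Lemma contractible_constant (R : realType) (K : topologicalType) (B : set K)
    (T : Type) (f : K -> T) : contractible R K B -> locally_constant_on B f ->
  forall x y, B x -> B y -> f x = f y.
Proof. by move=> [H [k cB]] lf; exact: (contraction_constant cB lf). Qed.

Lemma flat_unique (R : realType) (K : topologicalType) (B : set K)
    (G : groupType) (S : Type) (act : S -> G -> S) (h : K -> K -> G) u f :
    contractible R K B -> right_action act -> frame B h u -> flat act B h f ->
  exists s, forall x, B x -> f x = act s (u x).
Proof.
move=> cB aa fu ff; have [H [k0 [_ Bk0 _ _ _]]] := cB.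
exists (act (f k0) (u k0)^-1%g) => x Bx.
have := contractible_constant cB (flat_frame_constant aa fu ff) Bx Bk0.
by move=> <-; rewrite /= -{2}[u x]invgK (actK _ aa).
Qed.

(** * The circle and its universal cover *)

Lemma rV_continuous (R : realType) (X : topologicalType) (n : nat)
    (f : X -> 'rV[R]_n) :
  (forall i, continuous (fun x => f x ord0 i)) -> continuous f.
Proof.
move=> cf x W [P Pn PW].
have : \forall y \near x, forall i, P ord0 i (f y ord0 i).
  apply: filter_forall => i; exact: cf (Pn ord0 i).
apply: filterS => y Py; apply: PW => i j.
by rewrite (ord1 i); exact: Py.
Qed.

Lemma continuous_coord (R : realType) (X : topologicalType) (n : nat) i
    (f : X -> 'rV[R]_n) : continuous f -> continuous (fun x => f x ord0 i).
Proof. by move=> cf; exact: (continuous_compose cf (@coord_continuous _ _ _ ord0 i)). Qed.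

Lemma continuousMr (R : realType) (X : topologicalType) (a : R) (f : X -> R) :
  continuous f -> continuous (fun x => a * f x).
Proof. by move=> cf x; apply: cvgM; [exact: cvg_cst | exact: cf]. Qed.

Section Circle.
Context {R : realType}.
Local Notation e := (@circle_point R).
Local Notation S1 := (sphere R 1).

Lemma circle_cos t : e t ord0 ord0 = cos (2 * pi * t).
Proof. by rewrite mxE. Qed.

Lemma circle_sin t : e t ord0 ord_max = sin (2 * pi * t).
Proof. by rewrite mxE. Qed.

Lemma sphere1E v : S1 v <-> v ord0 ord0 ^+ 2 + v ord0 ord_max ^+ 2 = 1.
Proof.
rewrite /sphere /sqnorm /= big_ord_recl big_ord1.
by rewrite (_ : lift ord0 ord0 = ord_max)//; exact: val_inj.
Qed.

Lemma circle_eq (v w : 'rV[R]_2) : v ord0 ord0 = w ord0 ord0 ->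
  v ord0 ord_max = w ord0 ord_max -> v = w.
Proof.
move=> h0 h1; apply/rowP => -[[|[|//]]] i.
  by rewrite (_ : Ordinal i = ord0)//; exact: val_inj.
by rewrite (_ : Ordinal i = ord_max)//; exact: val_inj.
Qed.

Lemma circle_in t : S1 (e t).
Proof. by apply/sphere1E; rewrite circle_cos circle_sin; exact: cos2Dsin2. Qed.

Lemma circle_continuous : continuous e.
Proof.
have c2 : continuous (fun t : R => 2 * pi * t).
  by apply: continuousMr; exact: continuous_idfun.
apply: rV_continuous => i.
have -> : (fun t => e t ord0 i) =
    fun t => if i == ord0 then cos (2 * pi * t) else sin (2 * pi * t).
  by apply/funext => t; rewrite mxE.
case: (i == ord0).
  apply: (continuous_compose c2 (g := @cos R)).
  exact: continuous_cos.
apply: (continuous_compose c2 (g := @sin R)).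
exact: continuous_sin.
Qed.

Lemma cos_sin_surj (x y : R) : x ^+ 2 + y ^+ 2 = 1 ->
  exists t, x = cos t /\ y = sin t.
Proof.
move=> xy1; have x1 : -1 <= x <= 1.
  rewrite -ler_norml -(@expr_le1 _ 2)// real_normK ?num_real//.
  by rewrite -xy1 lerDl sqr_ge0.
have s1 : Num.sqrt (1 - x ^+ 2) = `|y|.
  by rewrite -xy1 addrC addKr sqrtr_sqr.
have x1' : x \in `[(-1 : R), 1] by rewrite in_itv.
have [y0|y0] := leP 0 y.
  by exists (acos x); rewrite acosK// sin_acos// s1 ger0_norm.
by exists (- acos x); rewrite cosN sinN acosK// sin_acos// s1 ltr0_norm// opprK.
Qed.

Let pi2_neq0 : 2 * pi != 0 :> R.
Proof. by rewrite mulf_neq0// gt_eqF ?pi_gt0. Qed.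

Lemma circle_surj v : S1 v -> exists t, e t = v.
Proof.
move=> /sphere1E /cos_sin_surj[t [h0 h1]]; exists (t / (2 * pi)).
by apply: circle_eq; rewrite ?circle_cos ?circle_sin ?h0 ?h1 mulrC divfK.
Qed.

Lemma circle_period t (n : int) : e (t + n%:~R) = e t.
Proof.
have eN m s : e (s + m%:R) = e s.
  apply: circle_eq; rewrite ?circle_cos ?circle_sin mulrDr mulr_natr mulr_natl.
    by rewrite (periodicn (@cosD2pi R)).
  by rewrite (periodicn (@sinD2pi R)).
case: n => n; first by rewrite -pmulrn eN.
by rewrite NegzE mulrNz -pmulrn -[in RHS](subrK n.+1%:R t) eN.
Qed.

Lemma circle_fiber s t : e s = e t -> exists n : int, t = s + n%:~R.
Proof.
(* [n] is an integer nearest to [t - s], so that [2 * pi * d] has absolute value at most [pi], where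
   the cosine is injective on absolute values. *)
move=> est; pose n := Num.floor (t - s + 1 / 2); exists n.
set d := t - s - n%:~R.
have d1 : -(1 / 2) <= d <= 1 / 2.
  have := floor_le (t - s + 1 / 2); have := floorD1_gt (t - s + 1 / 2).
  rewrite -/n intrD => h1 h2; rewrite /d; apply/andP; split; lra.
suff d0 : d = 0 by rewrite -[t](subrK s) -[t - s](subrK n%:~R) -/d d0 add0r addrC.
have ed : e d = e 0.
  have -> : e d = e (t - s).
    by rewrite -(circle_period d n) /d subrK.
  have c1 := circle_cos s; have s1 := circle_sin s.
  rewrite est circle_cos in c1; rewrite est circle_sin in s1.
  apply: circle_eq; rewrite ?circle_cos ?circle_sin mulrBr mulr0.
    by rewrite cosB c1 s1 -!expr2 cos2Dsin2 cos0.
  by rewrite sinB c1 s1 sin0 mulrC subrr.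
have c0 := circle_cos d; rewrite ed circle_cos mulr0 in c0.
rewrite -cos_norm -[X in _ = X]cos_norm normr0 in c0.
have pi0 := pi_gt0 R.
have : `|2 * pi * d| = 0.
  apply: (cos_inj _ _ (esym c0)).
    rewrite in_itv/= normr_ge0/= normrM ger0_norm ?mulr_ge0 ?pi_ge0//.
    have : `|d| <= 1 / 2 by rewrite ler_norml.
    rewrite -(ler_pM2l pi0) => hd; lra.
  by rewrite in_itv/= lexx ltW.
by move/normr0_eq0/eqP; rewrite mulf_eq0 (negbTE pi2_neq0) => /eqP.
Qed.

Lemma circle_inj s t : `|s - t| < 1 -> e s = e t -> s = t.
Proof.
move=> st /circle_fiber[n tn]; rewrite tn; rewrite tn in st.
have : `|n%:~R : R| < 1 by move: st; rewrite opprD addNKr normrN.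
rewrite -intr_norm -[1]/(1%:~R) ltr_int => n1.
have -> : n = 0 by move: n1; rewrite ltr_norml; lia.
by rewrite addr0.
Qed.

Lemma circle_open t W : nbhs t W ->
  \forall v \near e t, S1 v -> exists2 t', W t' & e t' = v.
Proof.
move=> tW.
pose c := cos (2 * pi * t); pose s := sin (2 * pi * t).
have cs1 : c ^+ 2 + s ^+ 2 = 1 := cos2Dsin2 _.
(* [y1] and [y2] are the coordinates of [v] after the rotation taking [e t] to (1, 0); where [y1] is
   positive, the arcsine of [y2] inverts [e]. *)
pose y1 (v : 'rV[R]_2) := c * v ord0 ord0 + s * v ord0 ord_max.
pose y2 (v : 'rV[R]_2) := c * v ord0 ord_max - s * v ord0 ord0.
have e0 := circle_cos t; have e1 := circle_sin t.
have y1t : y1 (e t) = 1 by rewrite /y1 e0 e1 -/c -/s -!expr2.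
have y2t : y2 (e t) = 0 by rewrite /y2 e0 e1 -/c -/s mulrC subrr.
have cc (a : R) i : continuous (fun v : 'rV[R]_2 => a * v ord0 i).
  by apply: continuousMr; exact: coord_continuous.
have cy1 : continuous y1 by move=> v; exact: cvgD (cc c ord0 v) (cc s ord_max v).
have cy2 : continuous y2 by move=> v; exact: cvgB (cc c ord_max v) (cc s ord0 v).
pose tau v := t + asin (y2 v) / (2 * pi).
have asin00 : asin (0 : R) = 0.
  by rewrite -[X in asin X]sin0 sinK// in_itv/= oppr_le0 divr_ge0// pi_ge0.
have taut : tau (e t) = t by rewrite /tau y2t asin00 mul0r addr0.
have ctau : {for e t, continuous tau}.
  have ca : {for y2 (e t), continuous (@asin R)}.
    by rewrite y2t; apply: continuous_asin; rewrite ltrN10 ltr01.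
  have cay := continuous_comp (cy2 (e t)) ca.
  exact: cvgD (cvg_cst t) (cvgM cay (cvg_cst (2 * pi)^-1)).
have n1 : \forall v \near e t, W (tau v) by apply: (ctau W); rewrite taut.
have n2 : \forall v \near e t, 0 < y1 v.
  by apply: (cy1 (e t) [set x | 0 < x]); rewrite y1t; apply: open_nbhs_nbhs; split; [exact: open_gt | exact: ltr01].
apply: filterS2 n1 n2 => v Wv y10 /sphere1E Sv; exists (tau v) => //.
have y12 : y1 v ^+ 2 + y2 v ^+ 2 = 1.
  by rewrite -[RHS]mulr1 -{1}cs1 -Sv /y1 /y2; ring.
have y21 : -1 <= y2 v <= 1.
  rewrite -ler_norml -(@expr_le1 _ 2)// real_normK ?num_real//.
  by rewrite -y12 lerDr sqr_ge0.
have ca : cos (asin (y2 v)) = y1 v.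
  by rewrite cos_asin// -y12 addrK sqrtr_sqr gtr0_norm.
have sa : sin (asin (y2 v)) = y2 v by rewrite asinK// in_itv.
apply: circle_eq; rewrite ?circle_cos ?circle_sin /tau mulrDr [2 * pi * (_ / _)]mulrC divfK//.
  rewrite cosD ca sa -/c -/s /y1 /y2.
  by rewrite -[RHS]mul1r -[in RHS]cs1; ring.
rewrite sinD ca sa -/c -/s /y1 /y2.
by rewrite -[RHS]mul1r -[in RHS]cs1; ring.
Qed.

End Circle.

(** Stands in for a covering map. Flatness descends along an open surjection, since every point of
    [A] near [F k] comes from a point of [B] near [k]. *)
Definition open_onto (K X : topologicalType) (B : set K) (F : K -> X)
    (A : set X) : Prop :=
  [/\ continuous F, forall k, B k -> A (F k),
      forall x, A x -> exists2 k, B k & F k = x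
    & forall k W, B k -> nbhs k W -> \forall x \near F k, A x ->
        exists k', [/\ W k', B k' & F k' = x]].

Lemma open_onto_id (X : topologicalType) (A : set X) :
  open_onto A (fun x => x) A.
Proof.
split=> // [|x Ax|k W Ak kW]; first exact: continuous_idfun.
  by exists x.
by apply: filterS kW => x Wx Ax; exists x.
Qed.

Lemma open_onto_prod (K L X Y : topologicalType) (B : set K) (C : set L)
    (F : K -> X) (E : L -> Y) (A : set X) (D : set Y) :
    open_onto B F A -> open_onto C E D ->
  open_onto (B `*` C) (fun x => (F x.1, E x.2)) (A `*` D).
Proof.
move=> [cF BF sF oF] [cE CE sE oE]; split.
- apply: continuous_pair.
    exact: continuous_compose (@continuous_fst _ _) cF.
  exact: continuous_compose (@continuous_snd _ _) cE.
- by move=> [k l] [/= /BF ? /CE ?].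
- move=> [x y] [/= /sF[k Bk <-] /sE[l Cl <-]]; first by exists (k, l).
- move=> [k l] W [/= Bk Cl] [[U V] /= [kU lV] UVW].
  exists ([set x | A x -> exists k', [/\ U k', B k' & F k' = x]],
    [set y | D y -> exists l', [/\ V l', C l' & E l' = y]]) => /=.
    by split; [exact: oF | exact: oE].
  move=> [x y] [/= Hx Hy] [/= /Hx[k' [Uk' Bk' <-]] /Hy[l' [Vl' Cl' <-]]].
  by exists (k', l'); split=> //; exact: (UVW (k', l')).
Qed.

Lemma open_onto_flat (K X : topologicalType) (B : set K) (F : K -> X)
    (A : set X) (G : groupType) (S : Type) (act : S -> G -> S)
    (h : X -> X -> G) (f : X -> S) :
  open_onto B F A -> flat act B (pull F h) (f \o F) -> flat act A h f.
Proof.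
move=> [cF BF sF oF] fB x Ax; have [k Bk Fk] := sF x Ax.
have [s fs] := fB k Bk; exists s; have := oF k _ Bk fs; rewrite Fk.
apply: filterS => y + Ay => /(_ Ay)[k' [/[swap] Bk' /(_ Bk')]].
by rewrite /pull /= Fk => + <- .
Qed.

(** Since [F] is invariant under [delta], [u \o delta] is another frame of the same system, and
    frames over a contractible set differ by a left factor. *)
Lemma deck_monodromy (R : realType) (K X : topologicalType) (B : set K)
    (F : K -> X) (G : groupType) (h : X -> X -> G) (u : K -> G) (delta : K -> K) :
    contractible R K B -> frame B (pull F h) u -> continuous delta ->
    (forall k, B k -> B (delta k)) -> (forall k, B k -> F (delta k) = F k) ->
  exists c, forall k, B k -> u (delta k) = (c * u k)%g.
Proof.
move=> cB fu cd dB Fd.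
apply: (flat_unique cB (regular_action G) fu (f := u \o delta)).
apply: (same_system_flat (regular_action G)
  _ (pull_flat (within_continuous cd) dB fu)).
by apply: eq_same_system => p x Bp Bx; rewrite /pull !Fd.
Qed.

(** * Local systems over the circle from periodic data on the line *)

Section CircleSystems.
Context {R : realType}.
Local Notation e := (@circle_point R).
Local Notation S1 := (sphere R 1).

Lemma circle_open_onto : open_onto setT e S1.
Proof.
split.
- exact: circle_continuous.
- by move=> t _; exact: circle_in.
- by move=> v /circle_surj[t <-]; exists t.
- move=> t W _ /circle_open; apply: filterS => v + Sv.
  by move=> /(_ Sv)[t' Wt' et']; exists t'.
Qed.

Definition angle (v : 'rV[R]_2) : R := xget 0 [set t | e t = v].

Lemma angleK v : S1 v -> e (angle v) = v.
Proof.
by move=> /circle_surj et; exact: (@xgetPex _ 0 [set t | e t = v] et).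
Qed.

Lemma angle_circle t : exists n : int, angle (e t) = t + n%:~R.
Proof. by apply: circle_fiber; rewrite angleK//; exact: circle_in. Qed.

(** The branch of the angle with values in the open interval of length 1 centred at [t], where [e]
    is injective. Where there is no such value, as at the antipode of [e t], it is the default 0. *)
Definition local_angle (t : R) (v : 'rV[R]_2) : R :=
  xget 0 [set t' | e t' = v /\ `|t' - t| < 1 / 2].

Lemma local_angle_circle t s : `|s - t| < 1 / 2 -> local_angle t (e s) = s.
Proof.
move=> st; rewrite /local_angle.
have [|] := @xgetPex _ 0 [set t' | e t' = e s /\ `|t' - t| < 1 / 2].
  by exists s.
set r := xget _ _ => ers rt; apply: circle_inj => //.
rewrite -(subrKA t) (le_lt_trans (ler_normD _ _))// [`|t - s|]distrC.
move: rt st; set x := `|_|; set y := `|_|; lra.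
Qed.

Section System.
Context (Z : topologicalType) (G : groupType) (U : R -> Z -> G).
Hypothesis periodU : forall n : int,
  exists c, forall s z, U (s + n%:~R) z = (c * U s z)%g.

(** Descends a frame [U] given on the universal cover: by [periodU], another choice of the angle of
    [p] changes the gauge by a left factor only, which is the freedom that gauges have. *)
Definition circle_system (p x : 'rV[R]_2 * Z) : G :=
  U (local_angle (angle p.1) x.1) x.2.

Lemma circle_systemE t z : exists c, \forall x \near (t, z),
  circle_system (e t, z) (e x.1, x.2) = (c * U x.1 x.2)%g.
Proof.
have [n an] := angle_circle t; have [c cU] := periodU n; exists c.
exists ([set s | `|s - t| < 1 / 2], setT) => /=.
  split; last exact: filterT.
  have := nbhsx_ballx t (1 / 2) _; rewrite divr_gt0// => /(_ isT).
  by apply: filterS => s; rewrite /ball /= distrC.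
move=> [s y] [/= st _]; rewrite /circle_system /= an -cU.
have sn : `|s + n%:~R - (t + n%:~R)| < 1 / 2 by rewrite opprD addrACA subrr addr0.
by rewrite -(circle_period s n) local_angle_circle.
Qed.

Lemma circle_system_local : local_system (S1 `*` setT) circle_system.
Proof.
have [cF _ _ oF] := open_onto_prod circle_open_onto (@open_onto_id Z setT).
move=> [v z] [/= Sv _]; set t := angle v.
have tW : nbhs (t, z) [set x | `|x.1 - t| < 1 / 2].
  exists ([set s | `|s - t| < 1 / 2], setT) => /=; last by move=> ? [].
  split; last exact: filterT.
  have := nbhsx_ballx t (1 / 2) _; rewrite divr_gt0// => /(_ isT).
  by apply: filterS => s; rewrite /ball /= distrC.
have tzT : (setT `*` setT) (t, z) by [].
have := oF _ _ tzT (nbhs_interior tW).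
rewrite /= angleK// => near_vz; apply: filterS near_vz => -[w y] + Swy.
move=> /(_ Swy) [[s y'] [/= sW _ [ew ey]]]; rewrite ey {y' ey} in sW.
have [c cU] := circle_systemE s y; rewrite ew in cU; exists c.
have := oF (s, y) _ (conj I I) (filterI cU sW); rewrite /= ew => near_sy.
apply: filterS (near_sy _) => x + Sx => /(_ Sx)[[s' z'] [/= [Hc st] _ <-]].
rewrite /= in Hc *; rewrite Hc.
by rewrite [in RHS]/circle_system /= -/t local_angle_circle.
Qed.

End System.
End CircleSystems.

(** * Contractible model sets *)

Section Contractible.
Context {R : realType}.

Lemma contractible_real : contractible R R setT.
Proof.
exists (fun x => x.1 * x.2), 0; split=> // [x|x|x]; rewrite /= ?mul0r ?mul1r//.
by apply: cvgM; [exact: cvg_fst | exact: cvg_snd].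
Qed.

Lemma contractible_segment : contractible R R `[(0 : R), 1].
Proof.
exists (fun x => x.1 * x.2), 0; split=> // [x||t k|x|x];
  rewrite /= ?mul0r ?mul1r//=.
- by apply: cvgM; [exact: cvg_fst | exact: cvg_snd].
- by rewrite in_itv/= lexx ler01.
- move=> /andP[t0 t1]; rewrite !in_itv/= => /andP[k0 k1].
  by rewrite mulr_ge0//= mulr_ile1.
Qed.

Lemma contractible_star (n : nat) (B : set 'rV[R]_n) :
    B 0 -> (forall t v, 0 <= t <= 1 -> B v -> B (t *: v)) ->
  contractible R 'rV[R]_n B.
Proof.
move=> B0 BZ; exists (fun x => x.1 *: x.2), 0.
split=> [||t v|v|v]; rewrite /= ?scale0r ?scale1r//; last exact: BZ.
apply: rV_continuous => i.
have -> : (fun x : R * 'rV[R]_n => (x.1 *: x.2) ord0 i) =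
  fun x => x.1 * x.2 ord0 i by apply/funext => x; rewrite mxE.
have cs := @continuous_coord R (R * 'rV[R]_n)%type n i _ (@continuous_snd R _).
by move=> x; exact: cvgM cvg_fst (cs x).
Qed.

Lemma contractible_rV (n : nat) : contractible R 'rV[R]_n setT.
Proof. exact: contractible_star. Qed.

Lemma contractible_disk (n : nat) : contractible R 'rV[R]_n (disk R n).
Proof.
apply: contractible_star; rewrite /disk /sqnorm /=.
  by rewrite big1 ?ler01// => i _; rewrite mxE expr0n.
move=> t v /andP[t0 t1] v1.
under eq_bigr do rewrite mxE exprMn.
rewrite -mulr_sumr mulr_ile1 ?sqr_ge0 ?sumr_ge0//.
  by move=> i _; exact: sqr_ge0.
by rewrite expr_le1.
Qed.

Lemma contractible_triangle : contractible R (R * R)%type (triangle R).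
Proof.
exists (fun x => (x.1 * x.2.1, x.1 * x.2.2)), (0, 0).
split=> [|||x|[x y]]; rewrite /= ?mul0r ?mul1r//=.
- apply: continuous_pair => x; apply: cvgM; try exact: cvg_fst.
    exact: (continuous_compose (@continuous_snd _ _) (@continuous_fst _ _)).
  exact: (continuous_compose (@continuous_snd _ _) (@continuous_snd _ _)).
- by split; rewrite /= ?addr0// ler01.
- move=> t [x y] /andP[t0 t1] [/= x0 y0 xy].
  split; rewrite /= ?mulr_ge0// -mulrDr mulr_ile1//.
  exact: addr_ge0.
Qed.

End Contractible.

(** * Cosets of abelian subgroups *)

(** The quotients generate an abelian subgroup, and [s] is a nonempty part of one of its right
    cosets. Allowing parts of cosets avoids naming the subgroup. *)
Definition abelian_coset (G : groupType) (s : set G) : Prop :=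
  s !=set0 /\ forall x y z w, s x -> s y -> s z -> s w ->
    commute (x * y^-1)%g (z * w^-1)%g.

Definition coset (G : groupType) := {s : set G | abelian_coset s}.

Section Cosets.
Context (G : groupType).
Implicit Types (s : coset G) (g k : G).

Lemma abelian_coset_mul s g : abelian_coset [set x * g | x in sval s]%g.
Proof.
case: s => s /= [[x0 sx0] sc]; split; first by exists (x0 * g)%g, x0.
move=> _ _ _ _ [x sx <-] [y sy <-] [z sz <-] [w sw <-].
by rewrite !mulgKA; exact: sc.
Qed.

Definition coset_act s g : coset G := exist _ _ (abelian_coset_mul s g).

Lemma coset_eq s1 s2 : sval s1 = sval s2 -> s1 = s2.
Proof. exact: eq_sig_hprop. Qed.

Lemma coset_action : right_action coset_act.
Proof.
split=> [s|s g k]; apply: coset_eq; apply/seteqP; split=> x /=.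
- by move=> [y sy <-]; rewrite mulg1.
- by move=> sx; exists x => //; rewrite mulg1.
- by move=> [_ [y sy <-] <-]; exists y => //; rewrite mulgA.
- by move=> [y sy <-]; exists (y * g)%g; [exists y | rewrite mulgA].
Qed.

(** For [x] in [s], the conjugates of [g] and [k] by [x] are quotients of elements of [s], hence
    commute. *)
Lemma coset_fix_commute s g k :
  coset_act s g = s -> coset_act s k = s -> commute g k.
Proof.
move=> sg sk; case: (proj2_sig s) => -[x sx] sc.
have sxg : sval s (x * g)%g by rewrite -sg /=; exists x.
have sxk : sval s (x * k)%g by rewrite -sk /=; exists x.
have := sc _ _ _ _ sxg sx sxk sx; rewrite /commute !mulgA !mulgVK.
by rewrite -!mulgA => /mulgI; rewrite !mulgA => /mulIg.
Qed.

(** An abelian subgroup is one of its own cosets. *)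
Lemma coset_fixed_by (P : set G) : P 1%g ->
    (forall g k, P g -> P k -> P (g * k)%g) -> (forall g, P g -> P g^-1%g) ->
    (forall g k, P g -> P k -> commute g k) ->
  exists s, forall g, P g -> coset_act s g = s.
Proof.
move=> P1 PM PV Pc; have Pa : abelian_coset P.
  by split; [exists 1%g | move=> x y z w *; apply: Pc; apply: PM => //; exact: PV].
exists (exist _ P Pa) => g Pg; apply: coset_eq; apply/seteqP; split=> x /=.
  by move=> [y Py <-]; exact: PM.
by move=> Px; exists (x * g^-1)%g; [apply: PM => //; exact: PV | rewrite mulgVK].
Qed.

End Cosets.

(** * Flat bundles on tori and solid tori *)

(** Meant for loops, where the two end values of a frame lie over the same point. *)
Definition trivial_holonomy (R : realType) (X : Type) (G : groupType)
    (h : X -> X -> G) (c : R -> X) : Prop :=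
  exists2 w : R -> G, frame `[(0 : R), 1] (pull c h) w & w 0 = w 1.

Section Tori.
Context {R : realType} (G : groupType).
Local Notation e := (@circle_point R).
Local Notation S1 := (sphere R 1).
Local Notation D2 := (disk R 2).

Lemma sphere_disk n : sphere R n `<=` disk R n.+1.
Proof. by move=> v; rewrite /sphere /disk /= => ->. Qed.

Definition torus_point (x : R * R) : 'rV[R]_2 * 'rV[R]_2 := (e x.1, e x.2).
Definition solid_torus_point (x : R * 'rV[R]_2) : 'rV[R]_2 * 'rV[R]_2 :=
  (e x.1, x.2).

Lemma torus_open_onto : open_onto setT torus_point (S1 `*` S1).
Proof. by rewrite -setXTT; exact: (open_onto_prod circle_open_onto circle_open_onto). Qed.

Lemma solid_torus_open_onto (D : set 'rV[R]_2) :
  open_onto (setT `*` D) solid_torus_point (S1 `*` D).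
Proof. exact: (open_onto_prod circle_open_onto (@open_onto_id _ D)). Qed.

Lemma contractible_plane : contractible R (R * R)%type setT.
Proof.
by rewrite -setXTT; exact: (contractible_prod contractible_real contractible_real).
Qed.

Lemma torus_frame (h : 'rV[R]_2 * 'rV[R]_2 -> 'rV[R]_2 * 'rV[R]_2 -> G) :
    local_system (S1 `*` S1) h ->
  exists2 u, frame setT (pull torus_point h) u & forall m n : int,
    exists c, forall s t, u (s + m%:~R, t + n%:~R) = (c * u (s, t))%g.
Proof.
move=> lh; have [cF BF _ _] := torus_open_onto.
have [u fu] := contractible_frame contractible_plane
  (pull_local_system (within_continuous cF) BF lh).
exists u => // m n.
have [|//||c cu] := deck_monodromy (delta := fun x : R * R => (x.1 + m%:~R, x.2 + n%:~R))
  contractible_plane fu.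
- apply: continuous_pair => x; apply: cvgD; try exact: cvg_cst.
    exact: cvg_fst.
  exact: cvg_snd.
- by move=> x _; rewrite /torus_point /= !circle_period.
- by exists c => s t; exact: (cu (s, t)).
Qed.

Lemma solid_torus_frame (h : 'rV[R]_2 * 'rV[R]_2 -> 'rV[R]_2 * 'rV[R]_2 -> G) :
    local_system (S1 `*` D2) h ->
  exists2 u, frame (setT `*` D2) (pull solid_torus_point h) u &
    forall n : int, exists c, forall s v, D2 v ->
      u (s + n%:~R, v) = (c * u (s, v))%g.
Proof.
move=> lh; have [cF BF _ _] := solid_torus_open_onto D2.
have cB : contractible R (R * 'rV[R]_2)%type (setT `*` D2).
  exact: (contractible_prod contractible_real (@contractible_disk R 2)).
have [u fu] := contractible_frame cB
  (pull_local_system (within_continuous cF) BF lh).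
exists u => // n.
have [|||c cu] := deck_monodromy (delta := fun x : R * 'rV[R]_2 => (x.1 + n%:~R, x.2)) cB fu.
- apply: continuous_pair; last exact: continuous_snd.
  by move=> x; apply: cvgD; [exact: cvg_fst | exact: cvg_cst].
- by move=> x [].
- by move=> x _; rewrite /solid_torus_point /= circle_period.
- by exists c => s v Dv; exact: (cu (s, v)).
Qed.

(** Every frame along [c] is a left translate of [u] along the lifted path, so holonomy is decided
    by the two ends of the lift. *)
Lemma torus_trivial_holonomy (h : 'rV[R]_2 * 'rV[R]_2 -> 'rV[R]_2 * 'rV[R]_2 -> G)
    (u : R * R -> G) (c1 c2 : R -> R) (c : R -> 'rV[R]_2 * 'rV[R]_2) :
    frame setT (pull torus_point h) u ->
    {within `[(0 : R), 1], continuous c1} ->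
    {within `[(0 : R), 1], continuous c2} ->
    (forall t, `[(0 : R), 1]%classic t -> c t = torus_point (c1 t, c2 t)) ->
  trivial_holonomy h c <-> u (c1 0, c2 0) = u (c1 1, c2 1).
Proof.
move=> fu /withinP cc1 /withinP cc2 cE.
have cc : {within `[(0 : R), 1], continuous (fun t => (c1 t, c2 t))}.
  apply/withinP => t It W [[U V] /= [/(cc1 _ It) Ut /(cc2 _ It) Vt] UV].
  by apply: filterS2 Ut Vt => s Us Vs Is; apply: UV; split; [exact: Us | exact: Vs].
have fc : frame `[(0 : R), 1] (pull c h) (u \o (fun t => (c1 t, c2 t))).
  apply: (same_system_flat (regular_action G) _ (pull_flat cc _ fu)) => //.
  by apply: eq_same_system => p x Ip Ix; rewrite /pull !cE.
have I0 : `[(0 : R), 1]%classic 0 by rewrite /= in_itv/= lexx ler01.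
have I1 : `[(0 : R), 1]%classic 1 by rewrite /= in_itv/= lexx ler01.
split=> [[w fw w01]|u01]; last by exists (u \o (fun t => (c1 t, c2 t))).
have [s sE] := flat_unique contractible_segment (regular_action G) fw fc.
by have := sE _ I0; have := sE _ I1; rewrite /= w01 => -> ->.
Qed.

(* The holonomy being trivial along the meridian, the bundle is induced from the
   longitude. *)
Lemma solid_torus_system (h : 'rV[R]_2 * 'rV[R]_2 -> 'rV[R]_2 * 'rV[R]_2 -> G) :
     local_system (S1 `*` S1) h ->
    trivial_holonomy h (fun t => (e 0, e t)) ->
  exists2 k, local_system (S1 `*` D2) k & same_system (S1 `*` S1) h k.
Proof.
move=> lh hol; have [u fu mono] := torus_frame lh.
have u01 : u (0, 0) = u (0, 1).
  apply: (torus_trivial_holonomy (c1 := fun=> 0) (c2 := fun t => t) fu _ _ _).1 hol => //.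
    by apply: within_continuous; exact: continuous_const.
  by apply: within_continuous; exact: continuous_idfun.
(* The monodromy of a translation is one left factor for the whole plane; seen at the origin, this
   one is 1. *)
have u1 s t : u (s, t + 1) = u (s, t).
  have [c cu] := mono 0 1; have := cu 0 0; rewrite !add0r -u01.
  rewrite -{1}[u (0, 0)]mul1g => /mulIg c1.
  by have := cu s t; rewrite addr0 -c1 mul1g.
have uN (m : nat) s t : u (s, t + m%:R) = u (s, t).
  by elim: m => [|m IHm]; rewrite ?addr0// -natr1 addrA u1.
have ut (n : int) s t : u (s, t + n%:~R) = u (s, t).
  case: n => m; first by rewrite -pmulrn uN.
  by rewrite NegzE mulrNz -pmulrn -[in RHS](subrK m.+1%:R t) uN.
(* Inside the disk any value would do, because gauges need not be continuous. On the boundary the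
   choice of the angle does not matter, by [ut]. *)
pose arg (v : 'rV[R]_2) : R := if `[< S1 v >] then angle v else 0.
pose U (s : R) (v : 'rV[R]_2) := u (s, arg v).
have perU (n : int) : exists c, forall s v, U (s + n%:~R) v = (c * U s v)%g.
  have [c cu] := mono n 0; exists c => s v.
  by rewrite /U -(cu s (arg v)) addr0.
exists (circle_system U).
  by apply: sub_local_system (circle_system_local perU) => x [].
have [_ _ _ oF] := torus_open_onto.
move=> [v w] [/= /circle_surj[s0 <-] /circle_surj[t0 <-]].
have [c ck] := circle_systemE perU s0 (e t0).
have [d dk] := fu (s0, t0) I.
have cj : continuous (fun x : R * R => (x.1, e x.2)).
  apply: continuous_pair; first exact: continuous_fst.
  exact: (continuous_compose (@continuous_snd _ _) circle_continuous).
have near1 := cj (s0, t0) _ ck.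
exists (c * d)%g.
have near2 := oF _ _ I (@filterI _ _ (nbhs_filter _) _ _ near1 dk).
apply: filterS near2 => x + Sx => /(_ Sx)[[s t] [/= [Hs Ht] _ <-]].
rewrite /= in Hs; rewrite /torus_point /= Hs /U /arg asboolT; last exact: circle_in.
by have [n ->] := angle_circle t; rewrite ut (Ht I) mulgA.
Qed.

End Tori.

(** The section on the boundary is described by one vector [s], which the monodromy of the longitude
    fixes. The longitude generates the monodromy of the solid torus, so [s] also describes a section
    inside. *)
Lemma solid_torus_flat (R : realType) (G : groupType) (S : Type)
    (act : S -> G -> S) (h : 'rV[R]_2 * 'rV[R]_2 -> 'rV[R]_2 * 'rV[R]_2 -> G)
    (f : 'rV[R]_2 * 'rV[R]_2 -> S) :
    right_action act -> local_system (sphere R 1 `*` disk R 2) h ->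
    flat act (sphere R 1 `*` sphere R 1) h f ->
  exists2 g, flat act (sphere R 1 `*` disk R 2) h g &
    forall x, (sphere R 1 `*` sphere R 1) x -> f x = g x.
Proof.
move=> aa lh ff; have [a1 aM] := aa; have [u fu mono] := solid_torus_frame lh.
pose J (x : R * R) := (x.1, circle_point x.2).
have cJ : continuous J.
  apply: continuous_pair; first exact: continuous_fst.
  exact: (continuous_compose (@continuous_snd _ _) circle_continuous).
have JD x : setT x -> ([set: R] `*` disk R 2) (J x).
  by move=> _; split=> //; apply: sphere_disk; exact: circle_in.
have fuJ : frame setT (pull torus_point h) (u \o J).
  exact: (pull_flat (within_continuous cJ) JD fu).
have [cT TT sT _] := @torus_open_onto R.
have [s sE] := flat_unique contractible_plane aa fuJ
  (pull_flat (within_continuous cT) TT ff).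
have su (n : int) t v : disk R 2 v -> act s (u (t + n%:~R, v)) = act s (u (t, v)).
  have [c cu] := mono n; move=> Dv; rewrite cu// -aM; congr (act _ _).
  have D1 : disk R 2 (circle_point 0) by apply: sphere_disk; exact: circle_in.
  have := sE (n%:~R, 0) I; have := sE (0, 0) I.
  rewrite /J /torus_point /= -[n%:~R]add0r circle_period cu// -aM => ->.
  by move=> /(congr1 (act^~ (u (0, circle_point 0))^-1%g)); rewrite !(actK _ aa).
exists (fun x => act s (u (angle x.1, x.2))); last first.
  move=> x /sT[[t1 t2] _ <-]; have := sE (t1, t2) I; rewrite /= => ->.
  have [n ->] := angle_circle t1; rewrite su//.
  by apply: sphere_disk; exact: circle_in.
apply: (open_onto_flat (solid_torus_open_onto _)).
apply: eq_flat (frame_flat s aa fu) => -[t v] [/= _ Dv].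
by have [n ->] := angle_circle t; rewrite su.
Qed.

(* A flat section of the associated bundle of cosets is a reduction of the
   structure group to an abelian subgroup: it exists when the holonomy group is
   abelian over each component. *)
Definition abelian_reducible (G : groupType) (X : topologicalType)
    (A : set X) : Prop :=
  forall h : X -> X -> G, local_system A h ->
  exists f, flat (@coset_act G) A h f.

Arguments abelian_reducible : clear implicits.

(** Translations of the universal cover commute, so their monodromies form an abelian subgroup [P].
    A coset fixed by [P], carried along by [u], is invariant under translations and descends. *)
Lemma torus3_reducible (R : realType) (G : groupType) :
  abelian_reducible G _ (sphere R 1 `*` sphere R 1 `*` sphere R 1).
Proof.
move=> h lh; have aa := coset_action G.
pose F (x : R * R * R) := (torus_point x.1, circle_point x.2).
have oF : open_onto setT F (sphere R 1 `*` sphere R 1 `*` sphere R 1).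
  by rewrite -setXTT; exact: (open_onto_prod torus_open_onto circle_open_onto).
have cK : contractible R (R * R * R)%type setT.
  by rewrite -setXTT; exact: (contractible_prod contractible_plane contractible_real).
have [cF BF sF _] := oF.
have [u fu] := contractible_frame cK
  (pull_local_system (within_continuous cF) BF lh).
pose tr (k l m : int) (x : R * R * R) : R * R * R :=
  (x.1.1 + k%:~R, x.1.2 + l%:~R, x.2 + m%:~R).
have trF k l m x : F (tr k l m x) = F x.
  by rewrite /F /tr /torus_point /= !circle_period.
have trD k l m k' l' m' x :
    tr k l m (tr k' l' m' x) = tr (k + k') (l + l') (m + m') x.
  by rewrite /tr /= !intrD ![k%:~R + _]addrC ![l%:~R + _]addrC ![m%:~R + _]addrC !addrA.
have mono k l m : exists c, forall x, u (tr k l m x) = (c * u x)%g.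
  have [|//|x _|c cu] := deck_monodromy (delta := tr k l m) cK fu.
  - have cadd (f : R * R * R -> R) (n : int) : continuous f ->
        continuous (fun x => f x + n%:~R).
      by move=> cf x; apply: cvgD; [exact: cf | exact: cvg_cst].
    have c1 := @continuous_fst (R * R)%type R.
    apply: continuous_pair; last by apply: cadd; exact: continuous_snd.
    apply: continuous_pair; apply: cadd; apply: (continuous_compose c1).
      exact: continuous_fst.
    exact: continuous_snd.
  - exact: trF.
  - by exists c => x; exact: cu.
pose P (g : G) := exists k l m, forall x, u (tr k l m x) = (g * u x)%g.
have PM (g g' : G) : P g -> P g' -> exists k l m,
    (forall x, u (tr k l m x) = (g * g' * u x)%g) /\
    (forall x, u (tr k l m x) = (g' * g * u x)%g).
  move=> [k [l [m gu]]] [k' [l' [m' gu']]].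
  exists (k + k'), (l + l'), (m + m'); split=> x.
    by rewrite -trD gu gu' mulgA.
  by rewrite [k + _]addrC [l + _]addrC [m + _]addrC -trD gu' gu mulgA.
have [|g g' /PM /[apply] [[k [l [m [gg' _]]]]]||g g' /PM /[apply]|s sP] :=
    coset_fixed_by (P := P).
- exists 0, 0, 0 => x; rewrite mul1g /tr !addr0.
  by case: x => [[? ?] ?].
- by exists k, l, m.
- move=> g [k [l [m gu]]]; exists (- k), (- l), (- m) => x.
  apply: (mulgI g); rewrite -gu trD !subrr mulVKg; congr u.
  by case: x => [[? ?] ?]; rewrite /tr /= !addr0.
- move=> [k [l [m [gg' g'g]]]]; apply: (mulIg (u 0)).
  by rewrite -gg' -g'g.
pose lift3 (x : 'rV[R]_2 * 'rV[R]_2 * 'rV[R]_2) :=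
  (angle x.1.1, angle x.1.2, angle x.2).
exists (fun x => coset_act s (u (lift3 x))).
apply: (open_onto_flat oF).
apply: eq_flat (frame_flat s aa fu) => -[[t1 t2] t3] _ /=.
rewrite /lift3 /F /torus_point /=.
have [k ->] := angle_circle t1; have [l ->] := angle_circle t2.
have [m ->] := angle_circle t3; have [c cu] := mono k l m.
have := cu (t1, t2, t3); rewrite /tr /= => ->; rewrite -(proj2 aa) (sP c)//.
by exists k, l, m.
Qed.

(* The bundle induced from the first factor with monodromy [g]. *)
Lemma circle_bundle (R : realType) (G : groupType) (g : G) (Z : topologicalType)
    (C : set Z) :
  exists2 h : 'rV[R]_2 * Z -> 'rV[R]_2 * Z -> G,
    local_system (sphere R 1 `*` C) h &
    forall (S : Type) (act : S -> G -> S) f, right_action act ->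
      flat act (sphere R 1 `*` C) h f ->
      forall x, (sphere R 1 `*` C) x -> act (f x) g = f x.
Proof.
pose gz (n : int) : G :=
  match n with Posz k => g ^+ k | Negz k => g ^- k.+1 end%g.
have gz1 (n : int) : gz (n + 1) = (g * gz n)%g.
  case: n => [k|[|k]].
  - by rewrite -PoszD addn1 /= expgS.
  - by rewrite /= expg1 mulgV.
  - have -> : Negz k.+1 + 1 = Negz k by lia.
    by rewrite /= [(g ^+ k.+2)%g]expgSr invgM mulVKg.
have gzc (n : int) : commute g (gz n).
  case: n => k; first exact: commuteX.
  by apply: commuteV; exact: commuteX.
have gzD (n : int) : exists c, forall m, gz (m + n) = (c * gz m)%g.
  case: n => k.
    elim: k => [|k [c IH]]; first by exists 1%g => m; rewrite addr0 mul1g.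
    by exists (g * c)%g => m; rewrite -addn1 PoszD addrA gz1 IH mulgA.
  elim: k => [|k [c IH]].
    exists g^-1%g => m; rewrite -[in RHS](subrK 1 m) gz1 mulKg.
    by congr gz; lia.
  exists (g^-1 * c)%g => m.
  rewrite -mulgA -IH -[m + Negz k](subrK 1) gz1 mulKg; congr gz; lia.
(* The jumps of the floor are harmless: only the behaviour under integer translations enters. *)
pose U (s : R) (z : Z) : G := gz (Num.floor s).
have perU (n : int) : exists c, forall s z, U (s + n%:~R) z = (c * U s z)%g.
  have [c cg] := gzD n; exists c => s z; rewrite /U -cg.
  by rewrite floorDrz ?intr_int//= intrKfloor.
exists (circle_system U).
  by apply: sub_local_system (circle_system_local perU) => x [].
move=> S act f aa ff [v z] [/= /circle_surj[t <-] Cz].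
have cj : continuous (fun s : R => (circle_point s, z)).
  by apply: continuous_pair; [exact: circle_continuous | exact: continuous_const].
have jC s : setT s -> (sphere R 1 `*` C) (circle_point s, z).
  by move=> _; split=> //; exact: circle_in.
have fs := pull_flat (within_continuous cj) jC ff.
have fU : frame setT (pull (fun s => (circle_point s, z)) (circle_system U)) (U^~ z).
  move=> s _; have [c cU] := circle_systemE perU s z; exists c^-1%g.
  have cp : continuous (fun s : R => (s, z)).
    by apply: continuous_pair; [exact: continuous_idfun | exact: continuous_const].
  have near1 : \forall r \near s, circle_system U (circle_point s, z)
      (circle_point r, z) = (c * U r z)%g by exact: (cp s _ cU).
  by apply: filterS near1 => r + _; rewrite /pull => ->; rewrite mulKg.
have [s sE] := flat_unique contractible_real aa fU fs.
(* The parameters [t] and [t + 1] name the same point, while [U] changes by the factor [g]. *)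
have /= e0 := sE t I; have e1 := sE (t + 1) I.
rewrite /= -[1]/(1%:~R) circle_period /U floorDrz ?intr_int//= intrKfloor in e1.
by rewrite e0 (proj2 aa) /U -gzc -gz1 -e1 -e0.
Qed.

(** * Gluing along a common boundary *)

Section Glued.
Context (X1 X2 Y : topologicalType) (A1 C1 : set X1) (A2 C2 : set X2).
Context (i1 : X1 -> Y) (i2 : X2 -> Y) (t : X2 -> X1).
Hypothesis Yglued : glued A1 C1 A2 C2 i1 i2.
Hypothesis hY : hausdorff_space Y.
Hypotheses (kA1 : compact A1) (kA2 : compact A2) (C2A2 : C2 `<=` A2).
Hypothesis tC : forall z, C2 z -> A1 (t z) /\ i1 (t z) = i2 z.

Let closed_embedded (X : topologicalType) (A : set X) (i : X -> Y) :
  compact A -> embeds A i -> closed (i @` A).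
Proof.
by move=> kA [ci _]; apply: compact_closed => //; exact: continuous_compact.
Qed.

Let in_boundary z : A2 z -> (i1 @` A1) (i2 z) -> C2 z.
Proof.
case: Yglued => _ [_ [g2 _ g2K]] _ i12 i1C A2z z1.
have : (i1 @` A1 `&` i2 @` A2) (i2 z) by split=> //; exists z.
rewrite i12 i1C => -[z' C2z' /(congr1 g2)].
by rewrite !g2K// => [<-//|]; exact: C2A2.
Qed.

(** The images of the two compact pieces are closed in the Hausdorff space [Y], so the systems,
    moved to [Y] by the inverse embeddings, glue along closed sets. *)
Lemma glued_system (G : groupType) (h1 : X1 -> X1 -> G) (h2 : X2 -> X2 -> G) :
    local_system A1 h1 -> local_system A2 h2 ->
    same_system C2 (pull t h1) h2 ->
  exists h, [/\ local_system setT h, same_system A1 (pull i1 h) h1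
              & same_system A2 (pull i2 h) h2].
Proof.
move=> l1 l2 h12; have [em1 em2 cov i12 i1C] := Yglued.
have [c1 [g1 cg1 g1K]] := em1; have [c2 [g2 cg2 g2K]] := em2.
have g1A x : (i1 @` A1) x -> A1 (g1 x) by move=> [y A1y <-]; rewrite g1K.
have g2A x : (i2 @` A2) x -> A2 (g2 x) by move=> [y A2y <-]; rewrite g2K.
have B2C x : (i1 @` A1 `&` i2 @` A2) x -> C2 (g2 x) /\ t (g2 x) = g1 x.
  move=> [x1 [z A2z iz]]; rewrite -iz in x1 *; rewrite g2K//.
  have C2z := in_boundary A2z x1; have [A1t it] := tC C2z.
  by split=> //; rewrite -it g1K.
have [|h [lh hh1 hh2]] := local_system_glue
    (closed_embedded kA1 em1) (closed_embedded kA2 em2) cov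
    (pull_local_system cg1 g1A l1) (pull_local_system cg2 g2A l2).
  have cg2' : {within i1 @` A1 `&` i2 @` A2, continuous g2}.
    by apply: within_subset cg2 => x [].
  have h12' : same_system (i1 @` A1 `&` i2 @` A2)
      (pull g2 (pull t h1)) (pull g2 h2).
    by apply: pull_same_system h12 => // x /B2C[].
  apply: (same_system_trans _ h12').
  apply: eq_same_system => p x /B2C[_ tp] /B2C[_ tx].
  by rewrite /pull tp tx.
exists h; split=> //.
  have hg : same_system A1 (pull i1 h) (pull i1 (pull g1 h1)).
    by apply: pull_same_system hh1 => // x A1x; exists x.
  apply: (same_system_trans hg).
  by apply: eq_same_system => p x Ap Ax; rewrite /pull !g1K.
have hg : same_system A2 (pull i2 h) (pull i2 (pull g2 h2)).
  by apply: pull_same_system hh2 => // x A2x; exists x.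
apply: (same_system_trans hg).
by apply: eq_same_system => p x Ap Ax; rewrite /pull !g2K.
Qed.

Lemma glued_flat (G : groupType) (S : Type) (act : S -> G -> S)
    (h : Y -> Y -> G) (f1 : X1 -> S) (f2 : X2 -> S) :
    right_action act ->
    flat act A1 (pull i1 h) f1 -> flat act A2 (pull i2 h) f2 ->
    (forall z, C2 z -> f1 (t z) = f2 z) ->
  exists f, flat act setT h f.
Proof.
move=> aa ff1 ff2 f12; have [em1 em2 cov i12 i1C] := Yglued.
have [c1 [g1 cg1 g1K]] := em1; have [c2 [g2 cg2 g2K]] := em2.
have g1A x : (i1 @` A1) x -> A1 (g1 x) by move=> [y A1y <-]; rewrite g1K.
have g2A x : (i2 @` A2) x -> A2 (g2 x) by move=> [y A2y <-]; rewrite g2K.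
have i1g1 x : (i1 @` A1) x -> i1 (g1 x) = x by move=> [y A1y <-]; rewrite g1K.
have i2g2 x : (i2 @` A2) x -> i2 (g2 x) = x by move=> [y A2y <-]; rewrite g2K.
exists (fun y => if `[< (i1 @` A1) y >] then f1 (g1 y) else f2 (g2 y)).
rewrite -cov; apply: flat_glue => //; try exact: closed_embedded.
  have := pull_flat cg1 g1A ff1; move/(same_system_flat aa) => H.
  have : flat act (i1 @` A1) h (f1 \o g1).
    apply: H; apply: eq_same_system => p x Ap Ax.
    by rewrite /pull !i1g1.
  by apply: eq_flat => x Ax; rewrite asboolT.
have := pull_flat cg2 g2A ff2; move/(same_system_flat aa) => H.
have : flat act (i2 @` A2) h (f2 \o g2).
  apply: H; apply: eq_same_system => p x Ap Ax.
  by rewrite /pull !i2g2.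
apply: eq_flat => x Ax; case: asboolP => // x1 /=.
have C2z : C2 (g2 x) by apply: in_boundary; rewrite ?i2g2//; exact: g2A.
by rewrite -f12//; have [A1t it] := tC C2z; rewrite -[X in g1 X](i2g2 _ Ax) -it g1K.
Qed.

End Glued.

(** * Winding numbers and homology in a torus *)

Section Winding.
Context {R : realType}.
Local Notation e := (@circle_point R).
Local Notation S1 := (sphere R 1).

Lemma local_angle_near (v : 'rV[R]_2) (W : set R) : S1 v -> nbhs (angle v) W ->
  \forall w \near v, S1 w -> W (local_angle (angle v) w) /\
    e (local_angle (angle v) w) = w.
Proof.
move=> Sv vW; set t := angle v.
have tW : nbhs t (W `&` [set s | `|s - t| < 1 / 2]).
  apply: filterI => //.
  have := nbhsx_ballx t (1 / 2) _; rewrite divr_gt0// => /(_ isT).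
  by apply: filterS => s; rewrite /ball /= distrC.
have := circle_open tW; rewrite /t angleK// => near_v; apply: filterS near_v.
move=> w + Sw => /(_ Sw)[s [Ws st] <-].
by rewrite local_angle_circle.
Qed.

(* The local determinations of the angle form a local system for the discrete
   group [(R, +)]; a lift is a frame of its pullback, up to a constant. *)
Lemma circle_lift (K : topologicalType) (B : set K) (g : K -> 'rV[R]_2) :
    contractible R K B -> {within B, continuous g} ->
    (forall k, B k -> S1 (g k)) ->
  exists2 f, {within B, continuous f} & forall k, B k -> e (f k) = g k.
Proof.
move=> cB cg gS; pose G : groupType := Algebra.to_multiplicative R.
pose U (s : R) (_ : R) : G := s.
have perU (n : int) : exists c : G, forall s z, U (s + n%:~R) z = (c * U s z)%g.
  by exists (n%:~R : R) => s z; exact: addrC.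
(* The second coordinate is a dummy: circle systems live over a product. *)
pose J k := (g k, 0 : R).
have cJ : {within B, continuous J}.
  apply/withinP => k Bk W [[V V'] /= [kV V'0] VW].
  have := (withinP _ _).1 cg k Bk V kV; apply: filterS => l + Bl => /(_ Bl) Vl.
  by apply: VW; split=> //; exact: nbhs_singleton.
have JS k : B k -> (S1 `*` setT) (J k) by move=> Bk; split=> //; exact: gS.
have [u fu] := contractible_frame cB
  (pull_local_system cJ JS (circle_system_local perU)).
have uE p : B p -> exists c : R, \forall k \near p, B k ->
    u k = c + local_angle (angle (g p)) (g k).
  exact: fu.
have near_g p W : B p -> nbhs (angle (g p)) W -> \forall k \near p, B k ->
    W (local_angle (angle (g p)) (g k)) /\
    e (local_angle (angle (g p)) (g k)) = g k.
  move=> Bp pW; exact: near_within_comp cg gS Bp (local_angle_near (gS _ Bp) pW).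
(* [angle] is ambiguous by integers only, so the offset of [u] from a true angle is constant modulo
   1; subtracting one value of it turns [u] into a lift. *)
have lc : locally_constant_on B (fun k => e (u k - angle (g k))).
  move=> p Bp; have [c cu] := uE p Bp.
  have near_c : \forall k \near p, B k -> e (u k - angle (g k)) = e c.
    apply: filterS2 cu (near_g p setT Bp filterT) => k uk gk Bk.
    rewrite uk//; have [_] := gk Bk; set s := local_angle _ _ => <-.
    have [n ->] := angle_circle s.
    by rewrite -[RHS](circle_period c (- n)) mulrNz opprD addrA addrK.
  have cp := nbhs_singleton near_c Bp.
  by apply: filterS near_c => k /[swap] Bk /(_ Bk) ->; rewrite cp.
have [_ [k0 [_ Bk0 _ _ _]]] := cB.
pose c0 := u k0 - angle (g k0); exists (fun k => u k - c0); last first.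
  move=> k Bk; have := contractible_constant cB lc Bk Bk0.
  move=> /circle_fiber[n c0E]; rewrite -(angleK (gS k Bk)).
  rewrite -[LHS](circle_period _ n); congr e.
  by move: c0E; rewrite -/c0 => ->; rewrite opprD opprB; ring.
apply/withinP => p Bp W pW; have [c cu] := uE p Bp.
have [e0 ge0] := nbhs_singleton (near_g p setT Bp filterT) Bp.
have up := nbhs_singleton cu Bp.
pose V s := W (c + s - c0).
have pV : nbhs (angle (g p)) V.
  have cV : continuous (fun s : R => c + s - c0).
    move=> s; apply: cvgB; last exact: cvg_cst.
    by apply: cvgD; [exact: cvg_cst | exact: cvg_id].
  apply: (cV (angle (g p))); move: pW; rewrite up.
  have -> : local_angle (angle (g p)) (g p) = angle (g p).
    rewrite -[in X in local_angle _ X](angleK (gS p Bp)) local_angle_circle//.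
    by rewrite subrr normr0 divr_gt0.
  by [].
by apply: filterS2 cu (near_g p V Bp pV) => k uk gk Bk; rewrite uk//; case: (gk Bk).
Qed.

(** The total variation of the angle is real-valued and makes sense for open paths: the edges of a
    singular triangle need not be loops. *)
Definition winding_spec (g : R -> 'rV[R]_2) (r : R) : Prop :=
  exists f : R -> R, [/\ {within `[(0 : R), 1], continuous f},
    forall t, 0 <= t <= 1 -> e (f t) = g t & r = f 1 - f 0].

Definition winding (g : R -> 'rV[R]_2) : R := xget 0 (winding_spec g).

Lemma winding_unique g r r' : winding_spec g r -> winding_spec g r' -> r = r'.
Proof.
move=> [f [/withinP cf fg ->]] [f' [/withinP cf' fg' ->]].
suff : f 0 - f' 0 = f 1 - f' 1 by lra.
apply: (segment_constant (f := fun t => f t - f' t)) => // p pI.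
have ball1 (q : R) : nbhs q [set s | `|s - q| < 1 / 2].
  have := nbhsx_ballx q (1 / 2) _; rewrite divr_gt0// => /(_ isT).
  by apply: filterS => s; rewrite /ball /= distrC.
apply: filterS2 (cf p pI _ (ball1 _)) (cf' p pI _ (ball1 _)) => t ft ft' tI.
have [n fn] : exists n : int, f' t = f t + n%:~R.
  by apply: circle_fiber; rewrite fg ?fg'//; move: tI; rewrite /= in_itv.
have [m fm] : exists m : int, f' p = f p + m%:~R.
  by apply: circle_fiber; rewrite fg ?fg'//; move: pI; rewrite /= in_itv.
(* Each lift moves by less than 1/2, so the two integer offsets differ by less than 1. *)
suff nm : n = m by rewrite fn fm nm; ring.
apply/eqP; rewrite -subr_eq0 -normr_le0 -ltzD1 add0r.
rewrite -(@ltr_int R) intr_norm intrB.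
have := ft tI; have := ft' tI; rewrite /= fn fm.
rewrite !ltr_norml => /andP[? ?] /andP[? ?]; apply/andP; split; lra.
Qed.

Lemma windingP g r : winding_spec g r -> winding g = r.
Proof.
move=> gr; apply: (winding_unique _ gr); apply: (@xgetPex _ 0 (winding_spec g)).
by exists r.
Qed.

Lemma eq_winding g g' : (forall t, 0 <= t <= 1 -> g t = g' t) ->
  winding g = winding g'.
Proof.
move=> gg'; rewrite /winding; congr xget; apply/seteqP; split=> r [f [cf fg rf]].
  by exists f; split=> // t t01; rewrite fg// gg'.
by exists f; split=> // t t01; rewrite fg// gg'.
Qed.

(** The angle lifts over the whole triangle, and the variations along the edges telescope: [winding]
    is a cocycle. *)
Lemma winding_triangle (g : R * R -> 'rV[R]_2) :
    {within triangle R, continuous g} -> (forall x, triangle R x -> S1 (g x)) ->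
  winding (fun t => g (1 - t, t)) - winding (fun t => g (0, t))
    + winding (fun t => g (t, 0)) = 0.
Proof.
move=> cg gS; have [f cf fg] := circle_lift contractible_triangle cg gS.
have edge (j : R -> R * R) : continuous j ->
    (forall t, 0 <= t <= 1 -> triangle R (j t)) ->
    winding (fun t => g (j t)) = f (j 1) - f (j 0).
  move=> cj jT; apply: windingP; exists (f \o j); split=> //.
    apply: within_comp (within_continuous cj) cf _ => t.
    by rewrite /= in_itv/=; exact: jT.
  by move=> t /jT /fg.
have c0 : continuous (fun=> 0 : R) := @continuous_const R R 0.
rewrite (edge (fun t => (1 - t, t))) ?(edge (fun t => (0, t))) ?(edge (fun t => (t, 0)))//.
- by rewrite subr0 subrr; ring.
- by apply: continuous_pair => //; exact: continuous_idfun.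
- by move=> t /andP[t0 t1]; split; rewrite /= ?addr0.
- by apply: continuous_pair => //; exact: continuous_idfun.
- by move=> t /andP[t0 t1]; split; rewrite /= ?add0r.
- apply: continuous_pair; last exact: continuous_idfun.
  by move=> t; apply: cvgB; [exact: cvg_cst | exact: cvg_id].
- by move=> t /andP[t0 t1]; split; rewrite /= ?subr_ge0// subrK.
Qed.

End Winding.

(** * Evaluation of cochains on singular 1-chains *)

Section Chains.
Context {R : realType} (X : topologicalType).
Implicit Types (c : chain1 R X) (p : R -> X) (W : (R -> X) -> R).

Definition agree p p' : Prop := forall t : R, 0 <= t <= 1 -> p t = p' t.

Definition chain_eval W c : R := \sum_(x <- c) x.1%:~R * W x.2.

(** Coefficients identify simplices that agree on [0, 1]. The induction removes from the list the
    whole class of its head, whose coefficients sum to zero. *)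
Lemma chain_eval_eq0 W c : (forall p p', agree p p' -> W p = W p') ->
  (forall p, coefficient c p = 0) -> chain_eval W c = 0.
Proof.
move=> Wext; have [n] := ubnP (size c); elim: n c => // n IH [|x c] szc c0.
  by rewrite /chain_eval big_nil.
pose P (y : int * (R -> X)) := `[< agree y.2 x.2 >].
rewrite /chain_eval (bigID P) /=.
have -> : \sum_(y <- x :: c | P y) y.1%:~R * W y.2 = 0.
  rewrite (eq_bigr (fun y => y.1%:~R * W x.2)); last first.
    by move=> y /asboolP yx; rewrite (Wext _ _ yx).
  rewrite -mulr_suml -[X in X * _](rmorph_sum intr).
  rewrite (_ : \sum_(i <- _ | _) _ = 0 :> int) ?mul0r//.
  exact: c0 x.2.
rewrite add0r -big_filter; apply: IH => [|p].
  rewrite /= /P asboolT//= size_filter.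
  rewrite ltnS /= in szc; exact: leq_ltn_trans (count_size _ _) szc.
rewrite /coefficient big_filter_cond.
have [px|npx] := pselect (agree p x.2).
  rewrite big1// => y /andP[/asboolPn nyx /asboolP yp]; exfalso; apply: nyx => t t01.
  by rewrite yp// px.
rewrite -[RHS](c0 p); apply: eq_bigl => y.
case: asboolP => [yp|]; rewrite ?andbF// andbT; apply/asboolPn => yx.
by apply: npx => t t01; rewrite -yp// yx.
Qed.

(** A cocycle vanishes on boundaries, and the formal difference of [c] and [c' ++ boundary s] has
    all coefficients zero. *)
Lemma chain_eval_homologous W (B : set X) c c' :
    (forall p p', agree p p' -> W p = W p') ->
    (forall g : R * R -> X, {within triangle R, continuous g} ->
      g @` triangle R `<=` B ->
      W (fun t => g (1 - t, t)) - W (fun t => g (0, t))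
        + W (fun t => g (t, 0)) = 0) ->
  homologous_in B c c' -> chain_eval W c = chain_eval W c'.
Proof.
move=> Wext Wtri [s sB cs].
pose neg (d : chain1 R X) := [seq (- x.1, x.2) | x <- d].
have eval_cat d d' : chain_eval W (d ++ d') = chain_eval W d + chain_eval W d'.
  exact: big_cat.
have eval_neg d : chain_eval W (neg d) = - chain_eval W d.
  rewrite /chain_eval big_map -sumrN; apply: eq_bigr => x _ /=.
  by rewrite mulrNz mulNr.
have coef_neg d p : coefficient (neg d) p = - coefficient d p.
  by rewrite /coefficient big_map -sumrN.
have eval_bd : chain_eval W (boundary s) = 0.
  elim: s sB {cs} => [|x s IH] sB; first by rewrite /chain_eval big_nil.
  have [[cx xB] sB'] := (List.Forall_cons_iff _ _ _).1 sB.
  have -> : boundary (x :: s) = [:: (x.1, fun t => x.2 (1 - t, t));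
      (- x.1, fun t => x.2 (0, t)); (x.1, fun t => x.2 (t, 0))] ++ boundary s by [].
  rewrite eval_cat IH// addr0.
  rewrite /chain_eval !big_cons big_nil /= mulrNz mulNr addr0 addrA.
  by rewrite -mulrBr -mulrDr Wtri ?mulr0.
have := @chain_eval_eq0 W (c ++ neg (c' ++ boundary s)) Wext.
rewrite eval_cat eval_neg eval_cat eval_bd addr0 => H.
apply/eqP; rewrite -subr_eq0; apply/eqP/H => p.
rewrite /coefficient big_cat -!/(coefficient _ p) coef_neg.
rewrite {2}/coefficient big_cat -!/(coefficient _ p) /=.
by rewrite opprD addrA cs subrr.
Qed.

End Chains.

(** The winding numbers of the two circle coordinates are cocycles on the torus, so the homology
    class fixes the displacement of a lift. The first coordinate runs along the core, hence it
    carries [b], the multiplicity of the longitude. *)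
Lemma homologous_lift (R : realType) (X : topologicalType)
    (phi : 'rV[R]_2 * 'rV[R]_2 -> X) (a b : int) (c : R -> X) :
    embeds (sphere R 1 `*` setT) phi ->
    {within `[(0 : R), 1], continuous c} ->
    (forall t, 0 <= t <= 1 -> (phi @` (sphere R 1 `*` sphere R 1)) (c t)) ->
    homologous_in (phi @` (sphere R 1 `*` sphere R 1)) [:: (1, c)]
      [:: (a, meridian phi); (b, longitude phi)] ->
  exists c1 c2 : R -> R, [/\ {within `[(0 : R), 1], continuous c1},
    {within `[(0 : R), 1], continuous c2},
    forall t, 0 <= t <= 1 -> c t = phi (torus_point (c1 t, c2 t)),
    c1 1 = c1 0 + b%:~R & c2 1 = c2 0 + a%:~R].
Proof.
move=> [cphi [psi cpsi psiK]] cc cT hom.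
set T := phi @` (sphere R 1 `*` sphere R 1) in cT hom.
have TS x : T x -> (sphere R 1 `*` sphere R 1) (psi x) /\ phi (psi x) = x.
  by move=> [y [Sy1 Sy2] <-]; rewrite psiK.
have cpsiT : {within T, continuous psi}.
  by apply: within_subset cpsi => x [y [Sy1 Sy2] <-]; exists y.
have proj (pr : 'rV[R]_2 * 'rV[R]_2 -> 'rV[R]_2) : continuous pr ->
    (forall x, (sphere R 1 `*` sphere R 1) x -> sphere R 1 (pr x)) ->
    exists2 f, {within `[(0 : R), 1], continuous f} &
      (forall t, 0 <= t <= 1 -> circle_point (f t) = pr (psi (c t))) /\
      f 1 - f 0 = a%:~R * winding (fun t => pr (psi (meridian phi t)))
        + b%:~R * winding (fun t => pr (psi (longitude phi t))).
  move=> cpr prS.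
  have cprT : {within T, continuous (pr \o psi)}.
    by apply: (within_comp cpsiT (B := setT)) => //; exact: within_continuous.
  have cI t : `[(0 : R), 1]%classic t -> T (c t).
    by rewrite /= in_itv/=; exact: cT.
  have [f cf fE] := circle_lift contractible_segment (within_comp cc cprT cI)
    (fun t It => prS _ (proj1 (TS _ (cI t It)))).
  have fE' t : 0 <= t <= 1 -> circle_point (f t) = pr (psi (c t)).
    by move=> t01; apply: fE; rewrite /= in_itv.
  exists f => //; split=> //.
  have := @chain_eval_homologous R X (fun p => winding (fun t => pr (psi (p t)))) T _ _ _ _ hom.
  rewrite /chain_eval !big_cons !big_nil /= mul1r !addr0 => <-.
  - by apply/esym; apply: windingP; exists f.
  - by move=> p p' pp'; apply: eq_winding => t t01; rewrite pp'.
  - move=> g cg gT; apply: (@winding_triangle R (pr \o psi \o g)).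
      by apply: within_comp cg cprT _ => x Dx; apply: gT; exists x.
    by move=> x Dx; apply: prS; case: (TS (g x)) => //; apply: gT; exists x.
have w0 : winding (fun=> circle_point (0 : R)) = 0.
  apply: windingP; exists (fun=> 0); split; rewrite ?subrr//.
  by apply: within_continuous; exact: continuous_const.
have w1 : winding (@circle_point R) = 1.
  apply: windingP; exists id; split; rewrite ?subr0//.
  by apply: within_continuous; exact: continuous_idfun.
have [|c1 cc1 [c1E c1w]] := proj fst (@continuous_fst _ _); first by move=> x [].
have [|c2 cc2 [c2E c2w]] := proj snd (@continuous_snd _ _); first by move=> x [].
have psim t : psi (meridian phi t) = (circle_point 0, circle_point t).
  by apply: psiK; split=> //; exact: circle_in.
have psil t : psi (longitude phi t) = (circle_point t, circle_point 0).
  by apply: psiK; split=> //; exact: circle_in.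
exists c1, c2; split=> //.
- move=> t t01; rewrite /torus_point c1E// c2E//= -surjective_pairing.
  by have [_ ->] := TS _ (cT t t01).
- have e1 : (fun t => (psi (meridian phi t)).1) = fun=> circle_point 0.
    by apply/funext => t; rewrite psim.
  have e2 : (fun t => (psi (longitude phi t)).1) = @circle_point R.
    by apply/funext => t; rewrite psil.
  by move: c1w; rewrite e1 e2 w0 w1; lra.
- have e1 : (fun t => (psi (meridian phi t)).2) = @circle_point R.
    by apply/funext => t; rewrite psim.
  have e2 : (fun t => (psi (longitude phi t)).2) = fun=> circle_point 0.
    by apply/funext => t; rewrite psil.
  by move: c2w; rewrite e1 e2 w0 w1; lra.
Qed.

(** * Invariance under surgery *)

Lemma continuous_sqnorm (R : realType) (n : nat) :
  continuous (@sqnorm R n).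
Proof.
rewrite /sqnorm; apply: continuous_big.
  by move=> x; apply: cvgD; [exact: cvg_fst | exact: cvg_snd].
move=> i _.
have -> : (fun v : 'rV[R]_n => v ord0 i ^+ 2) = fun v => v ord0 i * v ord0 i.
  by apply/funext => w; rewrite expr2.
have cv := @coord_continuous R 1 n ord0 i.
by move=> v; exact: cvgM (cv v) (cv v).
Qed.

Lemma open_open_disk (R : realType) (n : nat) : open (open_disk R n).
Proof.
have := (@continuousP _ _ (@sqnorm R n)).1 (@continuous_sqnorm R n) _ (@open_lt R 1).
exact.
Qed.

Lemma closed_disk (R : realType) (n : nat) : closed (disk R n).
Proof.
have := (@continuous_closedP _ _ (@sqnorm R n)).1 (@continuous_sqnorm R n)
  _ (@closed_le R 1).
exact.
Qed.

Lemma closed_sphere (R : realType) (n : nat) : closed (sphere R n).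
Proof.
have := (@continuous_closedP _ _ (@sqnorm R n.+1)).1 (@continuous_sqnorm R n.+1)
  _ (@closed_eq R 1).
exact.
Qed.

Lemma compact_disk (R : realType) (n : nat) : compact (disk R n).
Proof.
apply: (subclosed_compact (@closed_disk R n)
  (rV_compact (fun _ => @segment_compact R (-1) 1))) => v v1 i.
rewrite /= in_itv/= -ler_norml -(@expr_le1 _ 2)// real_normK ?num_real//.
apply: le_trans v1; rewrite /sqnorm (bigD1 i)//= lerDl sumr_ge0// => j _.
exact: sqr_ge0.
Qed.

Lemma compact_sphere (R : realType) (n : nat) : compact (sphere R n).
Proof.
exact: subclosed_compact (@closed_sphere R n) (@compact_disk R n.+1)
  (@sphere_disk R n).
Qed.

Lemma compact_solid_torus (R : realType) :
  compact (sphere R 1 `*` disk R 2).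
Proof. by apply: compact_setX; [exact: compact_sphere | exact: compact_disk]. Qed.

Lemma eq_trivial_holonomy (R : realType) (X Y : Type) (G : groupType)
    (h : X -> X -> G) (k : Y -> Y -> G) (c : R -> X) (c' : R -> Y) :
    (forall s t, 0 <= s <= 1 -> 0 <= t <= 1 -> h (c s) (c t) = k (c' s) (c' t)) ->
  trivial_holonomy h c -> trivial_holonomy k c'.
Proof.
move=> hk [w fw w01]; exists w => //.
apply: (same_system_flat (regular_action G) _ fw).
apply: eq_same_system => p x; rewrite /= !in_itv/= => pI xI.
by rewrite /pull hk.
Qed.

Lemma boundary_map (X1 X2 Y : topologicalType) (A1 C1 : set X1)
    (A2 C2 : set X2) (i1 : X1 -> Y) (i2 : X2 -> Y) :
    glued A1 C1 A2 C2 i1 i2 -> C1 `<=` A1 -> C2 `<=` A2 ->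
  exists2 t : X2 -> X1, {within C2, continuous t} &
    forall z, C2 z -> C1 (t z) /\ i1 (t z) = i2 z.
Proof.
move=> [[_ [g cg gK]] [ci2 _] _ _ iC] CA1 CA2.
have i2C z : C2 z -> exists2 x, C1 x & i1 x = i2 z.
  by move=> Cz; have : (i1 @` C1) (i2 z) by rewrite iC; exists z.
exists (g \o i2).
  apply: within_comp cg _; first exact: within_subset ci2.
  by move=> z /i2C[x /CA1 Ax <-]; exists x.
by move=> z /i2C[x Cx ix]; rewrite /= -ix gK//; exact: CA1.
Qed.

Section Transfer.
Context {R : realType} (G : groupType) (X Y Y' : topologicalType).
Context (E C : set X) (i : X -> Y) (j : 'rV[R]_2 * 'rV[R]_2 -> Y)
  (i' : X -> Y') (j' : 'rV[R]_2 * 'rV[R]_2 -> Y') (m m' : R -> X).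
Local Notation e := (@circle_point R).
Local Notation T := (sphere R 1 `*` sphere R 1).
Local Notation V := (sphere R 1 `*` disk R 2).

Let TV : T `<=` V.
Proof. by move=> x [? ?]; split=> //; exact: sphere_disk. Qed.

(** The loop bounds the image of a meridian disk, over which the system has a frame. *)
Lemma meridian_disk_trivial_holonomy (h : Y' -> Y' -> G) :
    {within V, continuous j'} -> local_system setT h ->
  trivial_holonomy h (fun t => j' (e 0, e t)).
Proof.
move=> cj lh; pose k v := j' (e 0, v).
have ck : {within disk R 2, continuous k}.
  apply: (within_comp (B := V) _ cj) => [|v Dv].
    apply: within_continuous; apply: continuous_pair.
      exact: continuous_const.
    exact: continuous_idfun.
  by split=> //; exact: circle_in.
have [u fu] := contractible_frame (@contractible_disk R 2)
  (pull_local_system (B := setT) ck (fun x _ => I) lh).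
exists (u \o e); last by rewrite /= -[1]add0r -[X in _ + X]/(1%:~R) circle_period.
apply: (pull_flat (B := disk R 2) _ _ fu) => [|t _].
  by apply: within_continuous; exact: circle_continuous.
by apply: sphere_disk; exact: circle_in.
Qed.

(** [Y] and [Y'] are fillings of the same exterior [E], with meridians [m] and [m']. A system on
    [Y'] has trivial holonomy along [m'], hence along [m], so its restriction to [E] extends to [Y].
    The section found on [Y] restricts to [E] and extends over the solid torus of [Y']. *)
Lemma reducible_transfer :
    glued E C V T i j -> glued E C V T i' j' -> C `<=` E -> compact E ->
    hausdorff_space Y -> hausdorff_space Y' ->
    (forall t, 0 <= t <= 1 -> E (m t) /\ i (m t) = j (e 0, e t)) ->
    (forall t, 0 <= t <= 1 -> E (m' t) /\ i' (m' t) = j' (e 0, e t)) ->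
    (forall h : X -> X -> G, local_system E h ->
      trivial_holonomy h m' -> trivial_holonomy h m) ->
  abelian_reducible G Y setT -> abelian_reducible G Y' setT.
Proof.
move=> gY gY' CE kE hY hY' mE mE' hol redY h' lh'; have aa := coset_action G.
have [t ct tC] := boundary_map gY CE TV.
have [t' ct' tC'] := boundary_map gY' CE TV.
have tE z : T z -> E (t z) /\ i (t z) = j z by move=> /tC[/CE].
have tE' z : T z -> E (t' z) /\ i' (t' z) = j' z by move=> /tC'[/CE].
have [[ci [g _ gK]] [cj _] _ _ _] := gY; have [[ci' _] [cj' _] _ _ _] := gY'.
have lE : local_system E (pull i' h').
  exact: (pull_local_system (B := setT) ci' (fun x _ => I) lh').
have tEE z : T z -> E (t z) by move=> /tE[].
have tEE' z : T z -> E (t' z) by move=> /tE'[].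
have [|k lk kT] := solid_torus_system (pull_local_system ct tEE lE).
  apply: (eq_trivial_holonomy (h := pull i' h') (c := m)) => [r s rI sI|].
    (* The identification [t] carries the standard meridian to [m], where [hol] applies. *)
    have tm q : 0 <= q <= 1 -> t (e 0, e q) = m q.
      move=> /mE[Em im].
      have [|Et it] := tE (e 0, e q); first by split; exact: circle_in.
      by rewrite -(gK _ Et) it -im gK.
    by rewrite /pull !tm.
  apply: hol => //.
  apply: (eq_trivial_holonomy (h := h') (c := fun t => j' (e 0, e t))).
    by move=> r s /mE'[_ rE] /mE'[_ sE]; rewrite /pull rE sE.
  exact: meridian_disk_trivial_holonomy.
have [h [lh hE _]] := glued_system gY hY kE (@compact_solid_torus R) TV tE lE lk kT.
have [f ff] := redY h lh.
have fE : flat (@coset_act G) E (pull i' h') (f \o i).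
  apply: (same_system_flat aa hE).
  exact: (pull_flat (B := setT) ci (fun x _ => I) ff).
have fT : flat (@coset_act G) T (pull j' h') (f \o i \o t').
  apply: (same_system_flat aa _ (pull_flat ct' tEE' fE)).
  apply: eq_same_system => p x /tE'[_ pE] /tE'[_ xE].
  by rewrite /pull pE xE.
have [g' fg' fg'T] := solid_torus_flat aa
  (pull_local_system (B := setT) cj' (fun x _ => I) lh') fT.
exact: (glued_flat gY' hY' kE (@compact_solid_torus R) TV tE' aa fE fg').
Qed.

End Transfer.

(** The shift by [n * s] along the longitude acts by an [n]-th power, hence trivially. The integers
    [m] with [K m], the periods of [u] along the meridian, form a subgroup containing [n]; if it
    also contains [q], it contains 1 by Bezout. *)
Lemma torus_holonomy_exponent (R : realType) (G : groupType) (u : R * R -> G)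
    (n : nat) (q s : int) (s0 t0 : R) :
    (forall g : G, g ^+ n = 1)%g -> coprimez q n%:Z ->
    (forall k l : int, exists c,
      forall s t, u (s + k%:~R, t + l%:~R) = (c * u (s, t))%g) ->
  u (s0, t0) = u (s0 + (n%:Z * s)%:~R, t0 + q%:~R) <-> u (0, 0) = u (0, 1).
Proof.
move=> expn cop mono.
pose K (m : int) := forall s t, u (s, t + m%:~R) = u (s, t).
have K1 (m : int) x y : u (x, y) = u (x, y + m%:~R) -> K m.
  have [c cu] := mono 0 m => uxy; have cE := cu x y.
  rewrite addr0 -uxy -{1}[u (x, y)]mul1g in cE; move/mulIg: cE => c1.
  by move=> x' y'; have := cu x' y'; rewrite addr0 -c1 mul1g.
have KD (m l : int) : K m -> K l -> K (m + l).
  by move=> Km Kl x y; rewrite intrD addrA Kl Km.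
have KN (m : int) : K m -> K (- m).
  by move=> Km x y; rewrite -(Km x (y + (- m)%:~R)) mulrNz subrK.
have KM (l m : int) : K m -> K (l * m).
  move=> Km; have KMn (a : nat) : K (a%:Z * m).
    elim: a => [|a IH]; first by move=> x y; rewrite mul0r addr0.
    by rewrite -addn1 PoszD mulrDl mul1r; exact: KD.
  by case: l => a //; rewrite NegzE mulNr; apply/KN.
have iter c (k l : int) : (forall x y, u (x + k%:~R, y + l%:~R) = (c * u (x, y))%g) ->
    forall (a : nat) x y,
    u (x + (a%:Z * k)%:~R, y + (a%:Z * l)%:~R) = (c ^+ a * u (x, y))%g.
  move=> cu; elim=> [|a IH] x y.
    by rewrite !mul0r !addr0 expg0 mul1g.
  rewrite -addn1 PoszD !mulrDl !mul1r !intrD !addrA cu IH mulgA.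
  by rewrite addn1 expgS.
have Kn : K n.
  move=> x y; have [c cu] := mono 0 1; have := iter _ _ _ cu n x y.
  by rewrite mulr0 addr0 mulr1 expn mul1g.
have un x y : u (x + (n%:Z * s)%:~R, y) = u (x, y).
  have [c cu] := mono s 0; have := iter _ _ _ cu n x y.
  by rewrite mulr0 addr0 expn mul1g.
rewrite un; split=> [/K1 Kq|u01].
  have [a [b ab]] := Bezoutz q n.
  have : K 1 by rewrite -(eqP cop) -ab; apply: KD; apply: KM.
  by move=> /(_ 0 0); rewrite add0r => ->.
have K11 : K 1 by apply: (K1 1 0 0); rewrite add0r.
by have := KM q 1 K11; rewrite mulr1 => ->.
Qed.

Lemma embeds_subset (X Y : topologicalType) (A B : set X) (f : X -> Y) :
  B `<=` A -> embeds A f -> embeds B f.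
Proof.
move=> BA [cf [g cg gK]]; split; first exact: within_subset cf.
exists g; last by move=> x /BA /gK.
by apply: within_subset cg => _ [x Bx <-]; exists x => //; exact: BA.
Qed.

Section Surgery.
Context {R : realType} (X : topologicalType) (phi : 'rV[R]_2 * 'rV[R]_2 -> X).
Hypothesis tub : tubular phi.
Local Notation S1 := (sphere R 1).
Local Notation exterior := (~` (phi @` (S1 `*` open_disk R 2))).
Local Notation torus := (phi @` (S1 `*` S1)).

(** The open solid torus is open in the tubular neighborhood by continuity of the inverse of [phi],
    and the neighborhood is open in [X]. *)
Lemma closed_exterior : closed exterior.
Proof.
case: tub => -[_ [psi /withinP cpsi psiK]] oO.
rewrite closedC openE => _ [z [Sz Dz] <-].
have zO : (phi @` (S1 `*` setT)) (phi z) by exists z.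
have zW : nbhs (psi (phi z)) [set y | open_disk R 2 y.2].
  rewrite psiK//; apply: (@continuous_snd _ _ z).
  by apply: open_nbhs_nbhs; split=> //; exact: open_open_disk.
have nO : nbhs (phi z) (phi @` (S1 `*` setT)) by exact: open_nbhs_nbhs.
apply: filterS2 nO (cpsi _ zO _ zW) => x xO /(_ xO) /=.
by case: xO => y [Sy _] <-; rewrite psiK// => Dy; exists y.
Qed.

Lemma torus_exterior : torus `<=` exterior.
Proof.
case: tub => -[_ [psi _ psiK]] _ _ [z [Sz Sz2] <-] [y [Sy Dy] yz].
have : psi (phi y) = psi (phi z) by rewrite yz.
rewrite !psiK// => yz'; move: Dy; rewrite yz' /open_disk /=.
by move: Sz2; rewrite /sphere /= => ->; rewrite ltxx.
Qed.

(** Presents the manifold as a filling of its own exterior, on the same footing as the result of the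
    surgery. *)
Lemma tubular_glued :
  glued exterior torus (S1 `*` disk R 2) (S1 `*` S1) id phi.
Proof.
have [ephi _] := tub; have [_ [psi _ psiK]] := ephi; split.
- split; first by apply: within_continuous; exact: continuous_idfun.
  by exists id => //; apply: within_continuous; exact: continuous_idfun.
- by apply: embeds_subset ephi => x [].
- apply/seteqP; split=> // x _.
  have [[z [Sz Dz] <-]|nx] := pselect ((phi @` (S1 `*` open_disk R 2)) x).
    by right; exists z => //; split=> //; exact: ltW.
  by left; exists x.
- rewrite !image_id; apply/seteqP; split=> x.
    move=> [nx [z [Sz Dz] zx]]; exists z => //; split=> //.
    apply/eqP; rewrite eq_le Dz /= leNgt; apply/negP => z1.
    by apply: nx; exists z.
  move=> Tx; split; first exact: torus_exterior.
  by case: Tx => z [Sz1 Sz2] <-; exists z => //; split=> //; exact: sphere_disk.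
- by rewrite image_id.
Qed.

End Surgery.

Lemma weak_surgery_reducible (R : realType) (G : groupType) (n : nat)
    (M M' : oriented_closed_3manifold R) :
    (forall g : G, g ^+ n = 1)%g -> weak_surgery n%:Z M M' ->
  abelian_reducible G M setT <-> abelian_reducible G M' setT.
Proof.
move=> expn [q [s [cop _ [_ [phi tub [i [j [c [gM' _ cE hom]]]]]]]]].
set E := (~` _) in gM'.
have gM := tubular_glued tub; rewrite -/E in gM.
have CE := torus_exterior tub; rewrite -/E in CE.
have kE : compact E.
  apply: (subclosed_compact _ (manifold_compact (o := M))) => //.
  exact: closed_exterior.
have [[ci [g cg gK]] [cj _] _ _ _] := gM'.
have jK t : (sphere R 1 `*` disk R 2) (circle_point 0, circle_point t).
  by split; [exact: circle_in | apply: sphere_disk; exact: circle_in].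
have Ec t : 0 <= t <= 1 -> E (c t) /\ i (c t) = j (circle_point 0, circle_point t).
  by move=> /cE[Tc ic]; split=> //; exact: (torus_exterior tub).
have Em t : 0 <= t <= 1 -> E (meridian phi t) /\
    id (meridian phi t) = phi (circle_point 0, circle_point t).
  move=> _; split=> //; apply: (torus_exterior tub).
  by exists (circle_point 0, circle_point t) => //; split; exact: circle_in.
(* The continuity of [c] is recovered from that of the meridian of [j] and of the inverse of [i]. *)
have cc : {within `[(0 : R), 1], continuous c}.
  apply: (within_eq (f := g \o (fun t => j (circle_point 0, circle_point t)))).
    move=> t; rewrite /= in_itv/= => /Ec[Et <-].
    by rewrite gK.
  apply: within_comp cg _.
    apply: (within_comp (B := sphere R 1 `*` disk R 2) _ cj) => //.
    apply: within_continuous; apply: continuous_pair.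
      exact: continuous_const.
    exact: circle_continuous.
  by move=> t; rewrite /= in_itv/= => /Ec[Et <-]; exists (c t).
have [c1 [c2 [cc1 cc2 cphi c1E c2E]]] := homologous_lift (proj1 tub) cc
  (fun t It => proj1 (cE t It)) hom.
(* In the plane the meridian lifts to a path from (0, 0) to (0, 1), and [c] to a path with
   displacement [(n * s, q)]. *)
have hol (h : M -> M -> G) : local_system E h ->
    trivial_holonomy h c <-> trivial_holonomy h (meridian phi).
  move=> lh.
  have cphiT : {within sphere R 1 `*` sphere R 1, continuous phi}.
    by apply: within_subset (proj1 (proj1 tub)) => x [].
  have phiE x : (sphere R 1 `*` sphere R 1) x -> E (phi x).
    by move=> Tx; apply: (torus_exterior tub); exists x.
  have [u fu mono] := torus_frame (pull_local_system cphiT phiE lh).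
  have holu (a1 a2 : R -> R) (a : R -> M) : {within `[(0 : R), 1], continuous a1} ->
      {within `[(0 : R), 1], continuous a2} ->
      (forall t, 0 <= t <= 1 -> a t = phi (torus_point (a1 t, a2 t))) ->
      trivial_holonomy h a <-> u (a1 0, a2 0) = u (a1 1, a2 1).
    move=> ca1 ca2 aE.
    rewrite -(torus_trivial_holonomy (c := fun t => torus_point (a1 t, a2 t)) fu ca1 ca2)//.
    by split; apply: eq_trivial_holonomy => r t rI tI; rewrite /pull !aE.
  rewrite (holu c1 c2)// (holu (fun=> 0) id)//; last first.
  - by apply: within_continuous; exact: continuous_idfun.
  - by apply: within_continuous; exact: continuous_const.
  rewrite c1E c2E.
  exact: torus_holonomy_exponent.
split.
  apply: (reducible_transfer gM gM' CE kE _ _ Em Ec) => [||h lh];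
    try exact: manifold_hausdorff.
  by move/(hol h lh).
apply: (reducible_transfer gM' gM CE kE _ _ Ec Em) => [||h lh];
  try exact: manifold_hausdorff.
by move/(hol h lh).
Qed.

Lemma embeds_reducible (X Y : topologicalType) (G : groupType) (A : set X)
    (f : X -> Y) : embeds A f ->
  abelian_reducible G X A <-> abelian_reducible G Y (f @` A).
Proof.
move=> [cf [g cg gK]]; have aa := coset_action G.
have fA x : A x -> (f @` A) (f x) by move=> Ax; exists x.
have gA y : (f @` A) y -> A (g y) by move=> [x Ax <-]; rewrite gK.
split=> red h lh.
  have [s fs] := red _ (pull_local_system cf fA lh); exists (s \o g).
  apply: (same_system_flat aa _ (pull_flat cg gA fs)).
  apply: eq_same_system => _ _ [p Ap <-] [x Ax <-].
  by rewrite /pull !gK.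
have [s fs] := red _ (pull_local_system cg gA lh); exists (s \o f).
apply: (same_system_flat aa _ (pull_flat cf fA fs)).
by apply: eq_same_system => p x Ap Ax; rewrite /pull !gK.
Qed.

(** * Connected sums *)

(** Spherical coordinates map the plane, which is contractible, continuously onto the sphere. *)
Lemma sphere2_constant (R : realType) (T : Type) (f : 'rV[R]_3 -> T) :
  locally_constant_on (sphere R 2) f ->
  forall x y, sphere R 2 x -> sphere R 2 y -> f x = f y.
Proof.
move=> lf; pose o1 : 'I_3 := lift ord0 ord0.
have cover3 (P : 'I_3 -> Prop) : P ord0 -> P o1 -> P ord_max -> forall i, P i.
  move=> P0 P1 P2 [[|[|[|//]]] i].
  - by rewrite (_ : Ordinal i = ord0)//; exact: val_inj.
  - by rewrite (_ : Ordinal i = o1)//; exact: val_inj.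
  - by rewrite (_ : Ordinal i = ord_max)//; exact: val_inj.
pose F (x : R * R) : 'rV[R]_3 := \row_i
  (if i == ord0 then cos x.1 * cos x.2
   else if i == o1 then cos x.1 * sin x.2 else sin x.1).
have F0 x : F x ord0 ord0 = cos x.1 * cos x.2 by rewrite mxE.
have F1 x : F x ord0 o1 = cos x.1 * sin x.2 by rewrite mxE.
have F2 x : F x ord0 ord_max = sin x.1 by rewrite mxE.
have sphereE v : sphere R 2 v <->
    (v ord0 ord0 ^+ 2 + v ord0 o1 ^+ 2) + v ord0 ord_max ^+ 2 = 1.
  rewrite /sphere /sqnorm /= !big_ord_recl big_ord0 addr0 addrA.
  by rewrite (_ : lift ord0 (lift ord0 ord0) = ord_max)//; exact: val_inj.
have FS x : sphere R 2 (F x).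
  apply/sphereE; rewrite F0 F1 F2 !exprMn -mulrDr.
  by rewrite cos2Dsin2 mulr1 cos2Dsin2.
have Fsurj v : sphere R 2 v -> exists x, F x = v.
  move=> /sphereE; set x := v ord0 ord0; set y := v ord0 o1; set z := v ord0 ord_max.
  move=> xyz; pose r := Num.sqrt (x ^+ 2 + y ^+ 2).
  have xy0 : 0 <= x ^+ 2 + y ^+ 2 by rewrite addr_ge0 ?sqr_ge0.
  have [a [ra za]] : exists a, r = cos a /\ z = sin a.
    by apply: cos_sin_surj; rewrite sqr_sqrtr.
  have [b [xb yb]] : exists b, x = r * cos b /\ y = r * sin b.
    (* At the poles the longitude is arbitrary; 0 is taken. *)
    have [r0|r0] := eqVneq r 0.
      exists 0; rewrite r0 !mul0r.
      have : x ^+ 2 + y ^+ 2 == 0.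
        by apply/eqP/le_anti; rewrite xy0 andbT -sqrtr_eq0 -/r r0.
      by rewrite paddr_eq0 ?sqr_ge0// !sqrf_eq0 => /andP[/eqP -> /eqP ->].
    have [|b [xb yb]] := @cos_sin_surj R (x / r) (y / r).
      have rr : r ^+ 2 = x ^+ 2 + y ^+ 2 by rewrite sqr_sqrtr.
      by rewrite !expr_div_n -mulrDl -rr divff// sqrf_eq0.
    by exists b; rewrite -xb -yb ![r * _]mulrC !divfK.
  exists (a, b); apply/rowP; apply: cover3.
  - by rewrite F0 -ra -xb.
  - by rewrite F1 -ra -yb.
  - by rewrite F2 -za.
have cc (g : R -> R) (pr : R * R -> R) : continuous g -> continuous pr ->
    continuous (fun x => g (pr x)).
  by move=> cg cpr; exact: continuous_compose cpr cg.
have cF : continuous F.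
  have c1 := @continuous_fst R R; have c2 := @continuous_snd R R.
  have m (g k : R * R -> R) : continuous g -> continuous k ->
      continuous (fun x => g x * k x).
    by move=> cg ck x; exact: cvgM (cg x) (ck x).
  have cs := @continuous_cos R; have sn := @continuous_sin R.
  apply: rV_continuous; apply: cover3.
  - have -> : (fun x => F x ord0 ord0) = fun x => cos x.1 * cos x.2.
      by apply/funext => x; rewrite F0.
    by apply: m; [exact: (cc _ _ cs c1) | exact: (cc _ _ cs c2)].
  - have -> : (fun x => F x ord0 o1) = fun x => cos x.1 * sin x.2.
      by apply/funext => x; rewrite F1.
    by apply: m; [exact: (cc _ _ cs c1) | exact: (cc _ _ sn c2)].
  - have -> : (fun x => F x ord0 ord_max) = fun x => sin x.1.
      by apply/funext => x; rewrite F2.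
    exact: (cc _ _ sn c1).
move=> _ _ /Fsurj[x <-] /Fsurj[y <-].
apply: (contractible_constant contractible_plane (f := f \o F)) => // p _.
exact: near_within_comp (within_continuous cF) (fun x _ => FS x) I (lf _ (FS p)).
Qed.

Lemma open_embedding_embeds (X Y : topologicalType) (e : X -> Y) (x0 : X) :
  open_embedding e -> embeds setT e.
Proof.
move=> [ce ie oe]; split; first exact: within_continuous.
pose g y := xget x0 [set x | e x = y].
have gK x : g (e x) = x.
  by apply: ie; apply: (@xgetPex _ x0 [set x' | e x' = e x]); exists x.
exists g => //; apply/withinP => _ [x _ <-] W; rewrite gK => xW.
have : nbhs (e x) (e @` interior W).
  by apply: open_nbhs_nbhs; split; [apply: oe; exact: open_interior | exists x].
by apply: filterS => _ [y /nbhs_singleton Wy <-] _; rewrite gK.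
Qed.

Section Puncture.
Context {R : realType} (M : oriented_closed_3manifold R) (e : 'rV[R]_3 -> M).
Hypothesis oe : open_embedding e.
Local Notation D := (e @` disk R 3).
Local Notation A := (~` (e @` open_disk R 3)).
Local Notation C := (e @` sphere R 2).

Lemma closed_puncture : closed A.
Proof.
by apply: open_closedC; case: oe => _ _; apply; exact: open_open_disk.
Qed.

Lemma sphere_puncture : C `<=` A.
Proof.
case: oe => _ ie _ _ [z Sz <-] [y Dy /ie yz]; move: Dy Sz.
by rewrite yz /open_disk /sphere /= => /[swap] ->; rewrite ltxx.
Qed.

(** A system made trivial on the boundary sphere can be glued to any other such system. A flat
    section outside the ball is then constant on the sphere, so it extends by a constant over the
    ball, and undoing the gauge change gives a section for [h]. *)
Lemma punctured_system (G : groupType) (h : M -> M -> G) :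
    local_system setT h ->
  exists k, [/\ local_system setT k, same_system C k (fun _ _ => 1%g)
    & forall S (act : S -> G -> S) f, right_action act -> flat act A k f ->
      exists2 f', flat act setT h f' &
        forall z, C z -> f z = f' (e 0)].
Proof.
move=> lh; have [ce [g cg gK]] := @open_embedding_embeds _ _ e (0 : 'rV[R]_3) oe.
(* With [u] normalized at 0, the gauge change is trivial at the centre of the ball, so the value on
   the sphere is the value of [f'] at [e 0]. *)
have [u fu] : exists2 u : 'rV[R]_3 -> G,
      frame setT (pull e h) u & u (0 : 'rV[R]_3) = 1%g.
  have [u fu] := contractible_frame (@contractible_rV R 3)
    (pull_local_system ce (fun x _ => I) lh).
  by exists (fun x => (u 0)^-1 * u x)%g; [exact: frame_mul | rewrite mulVg].
move=> u0.
(* Gauge transformation making the bundle trivial over the ball. *)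
pose v x : G := if `[< D x >] then u (g x) else 1%g.
pose k p x := (h p x * (v x)^-1)%g.
have lk : local_system setT k.
  move=> p _; apply: filterS (lh p I) => q + _ => /(_ I)[c cq]; exists c.
  by apply: filterS cq => x + _ => /(_ I); rewrite /k => ->; rewrite mulgA.
have kD : same_system D k (fun _ _ => 1%g).
  have cgD : {within D, continuous g}.
    by apply: within_subset cg => _ [x _ <-]; exists x.
  have fug : frame D (pull g (pull e h)) (u \o g).
    exact: (pull_flat (B := setT) cgD (fun _ _ => I) fu).
  move=> p Dp; have [c cp] := fug p Dp; exists c.
  apply: filterS cp => x + Dx => /(_ Dx) /= ux.
  rewrite /k /v asboolT// ux /pull.
  have egK y : D y -> e (g y) = y by move=> [y' _ <-]; rewrite gK.
  by rewrite !egK// invgM mulVKg mulgV.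
have CD : C `<=` D by move=> _ [z Sz <-]; exists z => //; exact: sphere_disk.
have CA := sphere_puncture.
exists k; split=> // [|S act f aa fA]; first exact: sub_same_system kD.
have fS : flat act (sphere R 2) (pull e (fun _ _ => 1%g)) (f \o e).
  have fC : flat act C (fun _ _ => 1%g) f.
    by apply: (same_system_flat aa (sub_same_system CD kD)); exact: sub_flat fA.
  apply: pull_flat fC; first exact: within_subset ce.
  by move=> x Sx; exists x.
have lf : locally_constant_on (sphere R 2) (f \o e).
  move=> p Sp; have [s fs] := fS p Sp; have fp := nbhs_singleton fs Sp.
  by apply: filterS fs => x + Sx => /(_ Sx) ->; rewrite fp.
have const := sphere2_constant lf.
pose z0 : 'rV[R]_3 := \row_i (i == ord0)%:R.
have Sz0 : sphere R 2 z0.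
  rewrite /sphere /sqnorm /= big_ord_recl mxE eqxx expr1n big1 ?addr0// => i _.
  by rewrite mxE /= expr0n.
pose f1 x := if `[< A x >] then f x else f (e z0).
have f1D x : D x -> f1 x = f (e z0).
  move=> [y Dy <-]; rewrite /f1; case: asboolP => // nA.
  apply: const => //; rewrite /sphere /=; apply/eqP; rewrite eq_le Dy /=.
  by rewrite leNgt; apply/negP => y1; apply: nA; exists y.
have ff1 : flat act setT k f1.
  have -> : setT = A `|` D.
    apply/seteqP; split=> // x _; have [[y Dy <-]|] := pselect ((e @` open_disk R 3) x).
      by right; exists y => //; exact: ltW.
    by left.
  apply: flat_glue => //.
  - exact: closed_puncture.
  - apply: compact_closed; first exact: manifold_hausdorff.
    apply: continuous_compact (@compact_disk R 3); exact: within_subset ce.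
  - by apply: eq_flat fA => x Ax; rewrite /f1 asboolT.
  - apply: (same_system_flat aa (same_system_sym kD)) => p Dp.
    exists (f (e z0)); apply: nearW => x Dx.
    by rewrite f1D//; case: aa => ->.
exists (fun x => act (f1 x) (v x)).
  move=> p _; have [s fs] := ff1 p I; exists s.
  apply: filterS fs => x + _ => /(_ I) ->.
  by rewrite (proj2 aa) /k mulgVK.
have De0 : D (e 0).
  exists 0 => //; rewrite /disk /sqnorm /= big1 ?ler01// => i _.
  by rewrite mxE expr0n.
move=> _ [z Sz <-]; rewrite f1D// /v asboolT//.
rewrite gK// u0 (proj1 aa).
exact: const.
Qed.

End Puncture.

(** The common value is the one taken on the sphere joining the summands, found again at the centres
    of both removed balls. It lets monodromies of different summands act on the same element. *)
Lemma connected_sum_system (R : realType) (M1 M2 M : oriented_closed_3manifold R)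
    (G : groupType) (h1 : M1 -> M1 -> G) (h2 : M2 -> M2 -> G) :
    connected_sum M1 M2 M -> local_system setT h1 -> local_system setT h2 ->
  exists2 h : M -> M -> G, local_system setT h &
    forall S (act : S -> G -> S) f, right_action act -> flat act setT h f ->
      exists f1 f2 x1 x2, [/\ flat act setT h1 f1, flat act setT h2 f2 &
        f1 x1 = f2 x2].
Proof.
move=> [e1 [e2 [i1 [i2 [oe1 oe2 gM _ _]]]]] l1 l2.
have [k1 [lk1 k1C k1f]] := punctured_system oe1 l1.
have [k2 [lk2 k2C k2f]] := punctured_system oe2 l2.
have CA1 := sphere_puncture oe1; have CA2 := sphere_puncture oe2.
have [t ct tC] := boundary_map gM CA1 CA2.
have [[ci1 _] [ci2 _] _ _ _] := gM.
have compactA (N : oriented_closed_3manifold R) (e : 'rV[R]_3 -> N) :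
    open_embedding e -> compact (~` (e @` open_disk R 3)).
  move=> oe; apply: (subclosed_compact (closed_puncture oe) (manifold_compact (o := N))).
  by [].
have [|h [lh h1E h2E]] := glued_system gM (manifold_hausdorff (o := M))
    (compactA _ _ oe1) (compactA _ _ oe2) CA2
    (fun z Cz => conj (CA1 _ (proj1 (tC z Cz))) (proj2 (tC z Cz)))
    (sub_local_system (fun x _ => I) lk1) (sub_local_system (fun x _ => I) lk2).
  apply: (same_system_trans _ (same_system_sym k2C)).
  exact: (pull_same_system ct (fun z Cz => proj1 (tC z Cz)) k1C).
exists h => // S act f aa ff.
have [|f1 ff1 f1E] := k1f S act (f \o i1) aa.
  apply: (same_system_flat aa h1E).
  exact: (pull_flat (B := setT) ci1 (fun x _ => I) ff).
have [|f2 ff2 f2E] := k2f S act (f \o i2) aa.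
  apply: (same_system_flat aa h2E).
  exact: (pull_flat (B := setT) ci2 (fun x _ => I) ff).
exists f1, f2, (e1 0), (e2 0); split=> //.
pose z0 : 'rV[R]_3 := \row_i (i == ord0)%:R.
have Cz0 : (e2 @` sphere R 2) (e2 z0).
  exists z0 => //; rewrite /sphere /sqnorm /= big_ord_recl mxE eqxx expr1n.
  by rewrite big1 ?addr0// => i _; rewrite mxE /= expr0n.
have [Ct it] := tC _ Cz0.
by rewrite -(f1E _ Ct) -(f2E _ Cz0) /= it.
Qed.

Lemma S1xS2_system (R : realType) (M : oriented_closed_3manifold R)
    (G : groupType) (g : G) : is_S1xS2 M ->
  exists2 h : M -> M -> G, local_system setT h &
    forall S (act : S -> G -> S) f, right_action act -> flat act setT h f ->
      forall x, act (f x) g = f x.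
Proof.
move=> [p [cp [q cq qK]] pM].
have [h lh hg] := circle_bundle R g (sphere R 2).
have pS x : setT x -> (sphere R 1 `*` sphere R 2) (p x).
  by move=> _; rewrite -pM; exists x.
exists (pull p h); first exact: (pull_local_system cp pS lh).
move=> S act f aa ff x; rewrite pM in cq.
have fq : flat act (sphere R 1 `*` sphere R 2) h (f \o q).
  apply: (same_system_flat aa _ (pull_flat (B := setT) cq (fun _ _ => I) ff)).
  apply: eq_same_system => y z; rewrite -pM => -[y' _ <-] [z' _ <-].
  by rewrite /pull !qK.
by have := hg S act _ aa fq (p x) (pS _ I); rewrite /= qK.
Qed.

(** Two summands get the monodromies [g] and [k], the third the trivial bundle. The coset common to
    the first two would be fixed by both [g] and [k], which would then commute. *)
Lemma sum3_irreducible (R : realType) (N : oriented_closed_3manifold R)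
    (G : groupType) (g k : G) : is_sum3_S1xS2 N -> ~ commute g k ->
  ~ abelian_reducible G N setT.
Proof.
move=> [A [B [C [P [SA SB _ sumP sumN]]]]] ngk red.
have [hA lA gA] := S1xS2_system g SA; have [hB lB kB] := S1xS2_system k SB.
have [hP lP fP] := connected_sum_system sumP lA lB.
have l1 : local_system setT (fun _ _ : C => 1%g : G).
  move=> p _; apply: nearW => q _; exists 1%g; apply: nearW => x _.
  by rewrite mulg1.
have [h lh fh] := connected_sum_system sumN lP l1.
have [f ff] := red h lh; have aa := coset_action G.
have [f1 [_ [_ [_ [ff1 _ _]]]]] := fh _ _ _ aa ff.
have [f2 [f3 [x2 [x3 [ff2 ff3 f23]]]]] := fP _ _ _ aa ff1.
apply: ngk; apply: (coset_fix_commute (gA _ _ _ aa ff2 x2)).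
by rewrite f23; exact: kB.
Qed.

(** * The twisted Heisenberg group *)

(* Doubling the cocycle of the Heisenberg group makes the exponent divide [n]
   also for even [n]; the group is not abelian as soon as [2 != 0] in [Z/n]. *)
Definition heisenberg (n : nat) : Type := ('Z_n * 'Z_n * 'Z_n)%type.

Section Heisenberg.
Variable n : nat.
Implicit Types x y z : heisenberg n.

Definition heis_one : heisenberg n := (0, 0, 0).
Definition heis_mul x y : heisenberg n :=
  (x.1.1 + y.1.1, x.1.2 + y.1.2, x.2 + y.2 + 2 * x.1.1 * y.1.2).
Definition heis_inv x : heisenberg n :=
  (- x.1.1, - x.1.2, - x.2 + 2 * x.1.1 * x.1.2).

Lemma heis_mulA : associative heis_mul.
Proof.
move=> [[a b] c] [[a' b'] c'] [[a'' b''] c'']; rewrite /heis_mul /=.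
by congr (_, _, _); ring.
Qed.

Lemma heis_mul1g : left_id heis_one heis_mul.
Proof. by move=> [[a b] c]; rewrite /heis_mul /=; congr (_, _, _); ring. Qed.

Lemma heis_mulg1 : right_id heis_one heis_mul.
Proof. by move=> [[a b] c]; rewrite /heis_mul /=; congr (_, _, _); ring. Qed.

Lemma heis_mulVg : left_inverse heis_one heis_inv heis_mul.
Proof.
by move=> [[a b] c]; rewrite /heis_mul /heis_one /=; congr (_, _, _); ring.
Qed.

Lemma heis_mulgV : right_inverse heis_one heis_inv heis_mul.
Proof.
by move=> [[a b] c]; rewrite /heis_mul /heis_one /=; congr (_, _, _); ring.
Qed.

HB.instance Definition _ := Choice.copy (heisenberg n) ('Z_n * 'Z_n * 'Z_n)%type.
HB.instance Definition _ := isGroup.Build (heisenberg n)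
  heis_mulA heis_mul1g heis_mulg1 heis_mulVg heis_mulgV.

Lemma heis_exponent x : (1 < n)%N -> (x ^+ n = 1)%g.
Proof.
move=> n1; case: x => [[a b] c].
(* The cocycle [2 * a * b] is counted k(k-1)/2 times; the factor 2 cancels the denominator and
   leaves a multiple of k. *)
have xk (k : nat) : ((((a, b, c) : heisenberg n) ^+ k)%g =
    (k%:R * a, k%:R * b, k%:R * c + k%:R * (k%:R - 1) * (a * b))
    :> heisenberg n).
  elim: k => [|k IH]; first by rewrite expg0 !mul0r addr0.
  rewrite expgS IH [LHS]/(heis_mul _ _) /heis_mul /= -natr1.
  by congr (_, _, _); ring.
have n0 : n%:R = 0 :> 'Z_n by exact: pchar_Zp.
by rewrite xk n0 !mul0r addr0.
Qed.

Lemma heis_noncommuting : (2 < n)%N ->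
  ~ commute ((1, 0, 0) : heisenberg n) ((0, 1, 0) : heisenberg n).
Proof.
(* The last coordinates of the two products are 2 and 0. *)
move=> n2 /(congr1 snd) E.
have : (0 + 0 + 2 * 1 * 1 : 'Z_n) = 0 + 0 + 2 * 0 * 0 := E.
rewrite !mulr1 !mulr0 !addr0 !add0r => /(congr1 (@nat_of_ord _)).
by rewrite val_Zp_nat ?(ltnW n2)// modn_small.
Qed.

End Heisenberg.

Theorem theorem1 (R : realType) (d : int) (hd : (2 < d)%R)
    (T N : oriented_closed_3manifold R)
    (hT : is_torus3 T) (hN : is_sum3_S1xS2 N) :
  ~ weakly_congruent d T N.
Proof.
case: d hd => // n n2 TN; pose G : groupType := heisenberg n.
have expG (g : G) : (g ^+ n = 1)%g by apply: heis_exponent; exact: ltnW.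
have invariant M M' : weakly_congruent n%:Z M M' ->
    abelian_reducible G M setT <-> abelian_reducible G M' setT.
  elim=> {M M'} [M M' [[f [ef fM' _]]|]|//|M M' _ ->//|M M' M'' _ -> _ ->//].
    by rewrite (embeds_reducible G ef) fM'.
  exact: weak_surgery_reducible expG.
have redT : abelian_reducible G T setT.
  case: hT => f ef fT; rewrite (embeds_reducible G ef) fT.
  exact: torus3_reducible.
apply: (@sum3_irreducible R N G _ _ hN (heis_noncommuting n2)).
exact: (invariant _ _ _ TN).1 redT.
Qed.
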